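(* Let $G$ be a relatively hyperbolic group and let $H$ be a non-parabolic subgroup of $G$. If $H$ has property $F\mathbb{R}$, then $H$ is Hopfian.
   Context: Relatively hyperbolic groups. Let $G$ be a group with a (possibly empty) family $\mathcal G$ of subgroups. $G$ is hyperbolic relative to $\mathcal G$ if $G$ acts properly discontinuously and isometrically on a proper, geodesic, (Gromov-)hyperbolic metric space $X$ so that the induced $G$-action on the ideal boundary $\partial X$ is the action of a geometrically finite convergence group whose maximal parabolic subgroups are precisely the elements of $\mathcal G$, and whose limit set is all of $\partial X$. Here an element is loxodromic if it has infinite order and exactly two fixed points in $\partial X$; a point $p\in\partial X$ is parabolic if its stabilizer in $G$ is infinite and contains no loxodromic element, and it is bounded parabolic if moreover its stabilizer acts cocompactly on $\partial X\setminus\{p\}$; the maximal parabolic subgroups are the stabilizers of parabolic points; a point $p\in\partial X$ is conical if there are $g_n\in G$ and distinct $a,b\in\partial X$ with $g_n p\to a$ and $g_n q\to b$ for all $q\in\partial X\setminus\{p\}$; the action is geometrically finite if every limit point is conical or bounded parabolic. Elements of $\mathcal G$ are called peripheral subgroups. $G$ need not be finitely generated. A relatively hyperbolic group is a group together with such a family $\mathcal G$. A subgroup of $G$ is called parabolic if it is contained in a peripheral (i.e. maximal parabolic) subgroup. A group $H$ has property $F\mathbb{R}$ if every isometric $H$-action on an $\mathbb{R}$-tree fixes a point. A group is Hopfian if every surjective endomorphism of it is injective. *)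

(* Defs.v *)
From HB Require Import structures.
From mathcomp Require Import all_boot all_order all_algebra generic_quotient.
From mathcomp Require Import all_classical all_reals all_analysis.

Set Implicit Arguments.
Unset Strict Implicit.
Unset Printing Implicit Defensive.

Import Order.TTheory GRing.Theory Num.Theory.
Import numFieldNormedType.Exports.

Local Open Scope classical_set_scope.
Local Open Scope ring_scope.

Section MetricSpaces.
Context {R : realType} {X : metricType R}.
Implicit Types (x y z o w : X) (S A B : set X).

Definition geodesic_segment x y S := exists gamma : R -> X,
  [/\ gamma 0 = x, gamma (mdist x y) = y,
      {in `[0, mdist x y] &, forall s t, mdist (gamma s) (gamma t) = `|s - t|}
    & S = gamma @` `[0, mdist x y]].

Definition gromov_product o x y : R :=
  (mdist x o + mdist y o - mdist x y) / 2.

End MetricSpaces.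

Section MetricSpaceProperties.
Context {R : realType} (X : metricType R).
Implicit Types (x y z w : X) (A B : set X).

Definition proper_space := forall x (r : R), compact [set y | mdist x y <= r].

Definition geodesic_space := forall x y, exists S, geodesic_segment x y S.

Definition gromov_hyperbolic := exists delta : R, forall w x y z,
  Num.min (gromov_product w x y) (gromov_product w y z) - delta
    <= gromov_product w x z.

(* Nonemptiness matters: every group acts on the empty space, without any     *)
(* fixed point.                                                               *)
Definition real_tree :=
  [/\ [set: X] !=set0,
      forall x y, exists! S, geodesic_segment x y S
    & forall x y z A B, geodesic_segment y x A -> geodesic_segment x z B ->
        A `&` B = [set x] -> geodesic_segment y z (A `|` B)].

End MetricSpaceProperties.

Record isometric_action {R : realType} (G : groupType) (X : metricType R) :=
  IsometricAction {
    iact :> G -> X -> X ;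
    iact1 : forall x, iact 1%g x = x ;
    iactM : forall g h x, iact (g * h)%g x = iact g (iact h x) ;
    iact_isometry : forall g x y, mdist (iact g x) (iact g y) = mdist x y }.

Definition properly_discontinuous {R : realType} {G : groupType}
    {X : metricType R} (a : isometric_action G X) :=
  forall K : set X, compact K -> finite_set [set g | (a g @` K) `&` K !=set0].

Section IdealBoundary.
Context {R : realType} (X : metricType R).

(* Only the restriction of the function to [0, +oo[ is meaningful; rays that  *)
(* differ only at negative times are identified in the ideal boundary.        *)
Record geodesic_ray := GeodesicRay {
  ray_fun :> R -> X ;
  ray_isometry : forall s t, 0 <= s -> 0 <= t ->
    mdist (ray_fun s) (ray_fun t) = `|s - t| }.

HB.instance Definition _ := gen_eqMixin geodesic_ray.
HB.instance Definition _ := gen_choiceMixin geodesic_ray.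

Definition asymptotic (c c' : geodesic_ray) : bool :=
  `[< exists K : R, forall t, 0 <= t -> mdist (c t) (c' t) <= K >].

Lemma asymptotic_refl : reflexive asymptotic.
Proof. by move=> c; apply/asboolP; exists 0 => t _; rewrite mdistxx. Qed.

Lemma asymptotic_sym : symmetric asymptotic.
Proof.
by move=> c c'; apply/asboolP/asboolP => -[K HK]; exists K => t t0;
  rewrite metric_sym; exact: HK.
Qed.

Lemma asymptotic_trans : transitive asymptotic.
Proof.
move=> c' c c'' /asboolP[K HK] /asboolP[L HL]; apply/asboolP; exists (K + L).
move=> t t0; apply: le_trans (metric_triangle _ (c' t) _) _.
by rewrite lerD ?HK ?HL.
Qed.

Canonical asymptotic_equiv :=
  EquivRel asymptotic asymptotic_refl asymptotic_sym asymptotic_trans.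

Definition ideal_boundary := {eq_quot asymptotic_equiv}%qT.
HB.instance Definition _ := Choice.on ideal_boundary.
HB.instance Definition _ := EqQuotient.on ideal_boundary.

Definition ray_end (c : geodesic_ray) : ideal_boundary :=
  \pi_ideal_boundary%qT c.

(* For X proper, geodesic and hyperbolic, the sets shadow o p r (r : R) form  *)
(* a neighbourhood basis of p in the usual topology of the boundary, for any  *)
(* choice of the basepoint o; as a consequence, boundary_open below describes *)
(* the open sets of that topology.                                            *)
Definition shadow (o : X) (p : ideal_boundary) (r : R) : set ideal_boundary :=
  [set q | exists c c' : geodesic_ray,
    [/\ c 0 = o, c' 0 = o, ray_end c = p, ray_end c' = q
      & \forall t \near +oo, r <= gromov_product o (c t) (c' t)]].

Definition boundary_open : set_system ideal_boundary :=
  [set U | forall p, U p -> forall o, exists r, shadow o p r `<=` U].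

Lemma boundary_openT : boundary_open setT.
Proof. by move=> p _ o; exists 0. Qed.

Lemma shadow_le o p r r' : r <= r' -> shadow o p r' `<=` shadow o p r.
Proof.
move=> rr' q [c [c' [co c'o cp c'q h]]]; exists c, c'; split => //.
by apply: filterS h => t; apply: le_trans.
Qed.

Lemma boundary_openI : setI_closed boundary_open.
Proof.
move=> U V oU oV p [Up Vp] o.
have [r rU] := oU p Up o; have [s sV] := oV p Vp o.
exists (Num.max r s) => q sq; split.
- by apply/rU/(shadow_le _ sq); rewrite le_max lexx.
- by apply/sV/(shadow_le _ sq); rewrite le_max lexx orbT.
Qed.

Lemma boundary_open_bigU (I : Type) (f : I -> set ideal_boundary) :
  (forall i, boundary_open (f i)) -> boundary_open (\bigcup_i f i).
Proof.
move=> fop p [i _ fip] o; have [r rf] := fop i p fip o.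
by exists r => q /rf fiq; exists i.
Qed.

HB.instance Definition _ := isOpenTopological.Build ideal_boundary
  boundary_openT boundary_openI boundary_open_bigU.

End IdealBoundary.

Section BoundaryAction.
Context {R : realType} {G : groupType} {X : metricType R}.
Variable a : isometric_action G X.

Definition ray_act (g : G) (c : geodesic_ray X) : geodesic_ray X.
Proof.
exists (fun t => a g (c t)) => s t s0 t0.
by rewrite iact_isometry ray_isometry.
Defined.

Definition boundary_act (g : G) (p : ideal_boundary X) : ideal_boundary X :=
  ray_end (ray_act g (repr p)).

Lemma ray_endP (c c' : geodesic_ray X) :
  ray_end c = ray_end c' <->
  exists K : R, forall t, 0 <= t -> mdist (c t) (c' t) <= K.
Proof.
split=> [/eqP|h]; rewrite /ray_end.
  by rewrite eqmodE => /asboolP.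
by apply/eqP; rewrite eqmodE; apply/asboolP.
Qed.

Lemma boundary_act_ray_end g c :
  boundary_act g (ray_end c) = ray_end (ray_act g c).
Proof.
apply/ray_endP; have /ray_endP[K HK] : ray_end (repr (ray_end c)) = ray_end c.
  exact: reprK.
by exists K => t t0 /=; rewrite iact_isometry HK.
Qed.

Lemma boundary_act1 p : boundary_act 1%g p = p.
Proof.
rewrite -[p]reprK -/(ray_end _); move: (repr p) => c.
rewrite boundary_act_ray_end; apply/ray_endP; exists 0 => t _ /=.
by rewrite iact1 mdistxx.
Qed.

Lemma boundary_actM g h p :
  boundary_act (g * h)%g p = boundary_act g (boundary_act h p).
Proof.
rewrite -[p]reprK -/(ray_end _); move: (repr p) => c.
rewrite (boundary_act_ray_end h) !boundary_act_ray_end.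
by apply/ray_endP; exists 0 => t _ /=; rewrite iactM mdistxx.
Qed.

End BoundaryAction.

Section ConvergenceGroups.
Context {G : groupType} {M : topologicalType}.
Variable a : G -> M -> M.
Implicit Types (g h : G) (p q x y : M).

(* Locally uniform convergence of the maps a (u n) to the constant map x on   *)
(* the complement of y.                                                       *)
Definition collapses (u : nat -> G) x y :=
  forall K : set M, compact K -> ~ K y ->
  forall U : set M, nbhs x U -> \forall n \near \oo, a (u n) @` K `<=` U.

Definition convergence_action :=
  [/\ compact [set: M], hausdorff_space M,
      forall g, continuous (a g)
    & forall u : nat -> G, injective u ->
        exists phi : nat -> nat, {homo phi : m n / (m < n)%N} /\
        exists x y, collapses (u \o phi) x y].

(* The limit set is taken to be the set of attracting points of collapsing    *)
(* sequences.                                                                 *)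
Definition limit_set : set M :=
  [set x | exists u : nat -> G, injective u /\ exists y, collapses u x y].

Definition stabilizer p : set G := [set g | a g p = p].

Definition loxodromic g :=
  (forall n, (0 < n)%N -> (g ^+ n <> 1)%g) /\
  exists p q, p <> q /\ [set x | a g x = x] = [set p; q].

Definition parabolic_point p :=
  infinite_set (stabilizer p) /\ forall g, stabilizer p g -> ~ loxodromic g.

Definition bounded_parabolic_point p :=
  parabolic_point p /\
  exists K : set M, [/\ compact K, ~ K p
    & forall q, q <> p -> exists2 g, stabilizer p g & K (a g q)].

Definition conical_point p :=
  exists (u : nat -> G) (x y : M), [/\ x <> y,
    a (u n) p @[n --> \oo] --> x
    & forall q, q <> p -> a (u n) q @[n --> \oo] --> y].

Definition geometrically_finite :=
  forall p, limit_set p -> conical_point p \/ bounded_parabolic_point p.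

Definition maximal_parabolic_subgroups : set (set G) :=
  stabilizer @` parabolic_point.

End ConvergenceGroups.

Definition relatively_hyperbolic (R : realType) (G : groupType)
    (peripheral : set (set G)) :=
  exists (X : metricType R) (a : isometric_action G X),
    [/\ [set: X] !=set0, proper_space X, geodesic_space X
      & gromov_hyperbolic X] /\
    [/\ properly_discontinuous a,
        convergence_action (boundary_act a),
        geometrically_finite (boundary_act a),
        maximal_parabolic_subgroups (boundary_act a) = peripheral
      & limit_set (boundary_act a) = setT].

Definition parabolic_subgroup (G : groupType) (peripheral : set (set G))
    (H : groupClosed G) :=
  exists2 P, peripheral P & forall g, g \in H -> P g.

Section SubgroupType.
Variables (G : groupType) (H : groupClosed G).

Definition subgroup_type := {g : G | g \in H}.
HB.instance Definition _ := SubChoice.on subgroup_type.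

Lemma subgroup_type_closed : group_closed (fun g : G => g \in H).
Proof. by split; [exact: gpred1 | exact: gpredF]. Qed.

HB.instance Definition _ := SubChoice_isSubGroup.Build G
  (fun g : G => g \in H) subgroup_type subgroup_type_closed.

End SubgroupType.

Definition property_FR (R : realType) (H : groupType) :=
  forall (T : metricType R) (a : isometric_action H T),
    real_tree T -> exists x, forall h, a h x = x.

Definition hopfian (H : groupType) :=
  forall f : {multiplicative H -> H},
    (forall y, exists x, f x = y) -> injective f.

(* Main.v *)
(* Let [f] be a surjective endomorphism of [H] and let [H] act on the          *)
(* hyperbolic space [X] through [f^n].  Property FR makes [H] finitely         *)
(* generated.  If the minimal displacements of a finite generating set tended  *)
(* to infinity with [n], the rescaled actions would converge, along an         *)
(* ultrafilter, to an action of [H] on a real tree without fixed point.  So    *)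
(* for infinitely many [n] the generators displace some [x_n] by at most [C].  *)
(* If [x_n] goes deep into the cusps of [X], then [f^n(H) = H] fixes a         *)
(* parabolic point; otherwise, up to conjugation, only finitely many           *)
(* restrictions of [f^n] to the generators occur, hence [f^n] and [f^m] have   *)
(* the same kernel for some [n < m], and [f] is injective.                     *)
From HB Require Import structures.
Require Import Defs.
From mathcomp Require Import all_boot all_order all_algebra.
From mathcomp Require Import generic_quotient.
From mathcomp Require Import all_classical all_reals all_analysis.
From mathcomp Require Import lra.

Set Implicit Arguments.
Unset Strict Implicit.
Unset Printing Implicit Defensive.

Import Order.TTheory GRing.Theory Num.Theory.
Import numFieldNormedType.Exports.

Local Open Scope classical_set_scope.
Local Open Scope ring_scope.

(** * Zero-hyperbolic spaces and property FR *)

Section FourPoint.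
Context {R : realType}.

(** The argument rescales actions in the manner of Bestvina and Paulin, then analyses the cusps. A
    surjective endomorphism [f] lets [H] act on [X] through every power [f^n], always with image
    [H]. If two powers agree on a finite generating set up to conjugation in [G], they have the same
    kernel, and two distinct powers with the same kernel force [f] to be injective
    ([stable_kernel_injective]). Only finitely many elements of [G] move [x0] a bounded distance, so
    by [pigeonhole_conjugate] it is enough that, for infinitely many [n], the generators move some
    point of the orbit of [x0] by a uniformly bounded amount.

    Property FR enters through [FR_fixed_point], applied to two trees. One is a tree of cosets and
    yields finite generation ([FR_finitely_generated]). The other is an ultralimit of rescaled
    copies of [X]: hyperbolicity is expressed by the four-point inequality, whose constant tends to
    0 under rescaling, and a geodesic space with constant 0 is a real tree. This gives points of [X]
    that the generators move boundedly ([FR_bounded_displacement]).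

    It remains to pass from points of [X] to points of the orbit ([thick_or_parabolic]). Almost
    fixed points that leave every neighbourhood of the orbit converge, after translation, to a
    boundary point whose horoballs the orbit does not enter deeply. Such a point is not conical
    ([cuspidal_not_conical]), hence it is bounded parabolic. Elements that barely move a point deep
    in its horoball fix it ([cusp_stabilizer]), and then [f^n(H) = H] would be parabolic. *)

Definition four_point (T : Type) (d : T -> T -> R) (delta : R) :=
  forall x y z w, d x y + d z w <= d x z + d y w + delta \/
                  d x y + d z w <= d x w + d y z + delta.

(** The endpoints are prescribed only up to distance 0, so that the notion makes sense for
    pseudometrics. *)
Definition isometric_path (T : Type) (d : T -> T -> R) (x y : T) (c : R -> T) :=
  [/\ d (c 0) x = 0, d (c (d x y)) y = 0
    & forall s t, 0 <= s <= d x y -> 0 <= t <= d x y ->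
      d (c s) (c t) = `|s - t|].

Lemma hyperbolic_four_point (X : metricType R) : [set: X] !=set0 ->
  gromov_hyperbolic X ->
  exists2 delta : R, 0 <= delta & four_point (@mdist R X) delta.
Proof.
move=> [x0 _] [delta hyp].
have fp : four_point (@mdist R X) (2 * delta).
  move=> x y z w; have := hyp w x z y; rewrite lerBlDr ge_min /gromov_product.
  by rewrite (metric_sym z y) => /orP[]h; [left|right]; lra.
exists (2 * delta) => //; have := fp x0 x0 x0 x0; rewrite mdistxx; lra.
Qed.

End FourPoint.

(** The trees below arise as pseudometric spaces; points at distance 0 are identified only when
    property FR is applied. *)
Record pmetric (R : realType) := PMetric {
  pcar :> Type;
  pdist : pcar -> pcar -> R;
  pdistxx : forall x, pdist x x = 0;
  pdistC : forall x y, pdist x y = pdist y x;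
  pdist_triangle : forall y x z, pdist x z <= pdist x y + pdist y z }.

Section Kolmogorov.
Context {R : realType} (Y : pmetric R).

Lemma pdist_ge0 (x y : Y) : 0 <= pdist x y.
Proof. by have := pdist_triangle y x x; rewrite pdistxx (pdistC y x); lra. Qed.

Definition pdist_eq (x y : {classic Y}) : bool := @pdist R Y x y == 0.

Lemma pdist_eq_refl : reflexive pdist_eq.
Proof. by move=> x; rewrite /pdist_eq pdistxx. Qed.
Lemma pdist_eq_sym : symmetric pdist_eq.
Proof. by move=> x y; rewrite /pdist_eq pdistC. Qed.
Lemma pdist_eq_trans : transitive pdist_eq.
Proof.
move=> y x z /eqP xy /eqP yz; apply/eqP.
have := @pdist_triangle R Y y x z; have := @pdist_ge0 x z; lra.
Qed.

Canonical pdist_equiv := EquivRel pdist_eq pdist_eq_refl pdist_eq_sym pdist_eq_trans.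

Definition kolmogorov := {eq_quot pdist_equiv}%qT.
HB.instance Definition _ := Choice.on kolmogorov.
HB.instance Definition _ := EqQuotient.on kolmogorov.

Definition kproj (y : Y) : kolmogorov := (\pi_kolmogorov%qT (y : {classic Y})).
Definition krep (u : kolmogorov) : Y := repr u.

Lemma krepK u : kproj (krep u) = u.
Proof. exact: reprK. Qed.

Lemma kprojP x y : kproj x = kproj y <-> pdist x y = 0.
Proof.
split=> [/eqP|h]; rewrite /kproj; first by rewrite eqmodE => /eqP.
by apply/eqP; rewrite eqmodE; apply/eqP.
Qed.

Definition kdist (u v : kolmogorov) : R := pdist (krep u) (krep v).
Lemma kdistE x y : kdist (kproj x) (kproj y) = pdist x y.
Proof.
rewrite /kdist.
have /kprojP hx := krepK (kproj x); have /kprojP hy := krepK (kproj y).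
have := pdist_triangle x (krep (kproj x)) (krep (kproj y)).
have := pdist_triangle y x (krep (kproj y)).
have := pdist_triangle (krep (kproj x)) x y.
have := pdist_triangle (krep (kproj y)) (krep (kproj x)) y.
rewrite (pdistC y) (pdistC x (krep _)) hx hy; lra.
Qed.
Lemma kdistxx u : kdist u u = 0.
Proof. exact: pdistxx. Qed.
Lemma kdist_positivity u v : kdist u v = 0 -> u = v.
Proof. by move=> h; rewrite -(krepK u) -(krepK v); apply/kprojP. Qed.
Lemma kdistC u v : kdist u v = kdist v u.
Proof. exact: pdistC. Qed.
Lemma kdist_triangle v u w : kdist u w <= kdist u v + kdist v w.
Proof. exact: pdist_triangle. Qed.

HB.instance Definition _ := isMetric.Build R kolmogorov
  kdistxx kdist_positivity kdistC kdist_triangle.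

Lemma mdist_kproj x y : mdist (kproj x) (kproj y) = pdist x y.
Proof. exact: kdistE. Qed.
End Kolmogorov.

Section ZeroHyperbolic.
Context {R : realType} (T : metricType R).
Hypothesis fp : four_point (@mdist R T) 0.

(** A point [z] of the metric interval coincides with the point of the segment at the same distance
    from [x]: both sums on the other side of the four-point inequality equal [mdist x y]. Uniqueness
    of geodesics follows. *)
Lemma geodesic_segmentE (x y : T) S : geodesic_segment x y S ->
  S = [set z | mdist x z + mdist z y = mdist x y].
Proof.
have d0 := mdist_ge0 x y.
move=> [c [c0 c1 ciso ->]]; have cx t : 0 <= t <= mdist x y -> mdist x (c t) = t.
  move=> /andP[t0 t1]; rewrite -{1}c0 ciso ?in_itv/= ?lexx ?t0 ?d0//.
  by rewrite sub0r normrN ger0_norm.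
have cy t : 0 <= t <= mdist x y -> mdist (c t) y = mdist x y - t.
  move=> /andP[t0 t1]; rewrite -{1}c1 ciso ?in_itv/= ?lexx ?t0 ?d0//.
  by rewrite distrC ger0_norm// subr_ge0.
apply/seteqP; split=> [_ [t /= + <-]|z /= hz].
  by rewrite in_itv/= => ht; rewrite cx// cy//; lra.
have ht : 0 <= mdist x z <= mdist x y.
  by rewrite mdist_ge0 -hz lerDl mdist_ge0.
exists (mdist x z); first by rewrite in_itv.
apply: mdist_positivity; have := fp (c (mdist x z)) z x y.
have := cx _ ht; have := cy _ ht.
rewrite (metric_sym (c _) x) (metric_sym z x).
have := mdist_ge0 (c (mdist x z)) z.
by move=> ? ? ? []; lra.
Qed.

Lemma zero_hyperbolic_real_tree :
  [set: T] !=set0 -> geodesic_space T -> real_tree T.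
Proof.
move=> T0 geo; split=> // [x y|x y z A B hA hB AB].
  have [S hS] := geo x y; exists S; split=> // S' hS'.
  by rewrite (geodesic_segmentE hS) (geodesic_segmentE hS').
suff yz : mdist y x + mdist x z = mdist y z.
  have [C hC] := geo y z; suff -> : A `|` B = C by [].
  rewrite (geodesic_segmentE hA) (geodesic_segmentE hB) (geodesic_segmentE hC).
  apply/seteqP; split=> w /=.
    have := metric_triangle y w z; have := metric_triangle y x w.
    have := metric_triangle w x z; rewrite (metric_sym w x).
    by move=> ? ? ? [] ?; lra.
  move=> hw; have := fp x w y z; rewrite (metric_sym w y) (metric_sym x y).
  have := metric_triangle y x w; have := metric_triangle y w x.
  have := metric_triangle x w z; have := metric_triangle w x z.
  by rewrite (metric_sym w x); move=> ? ? ? ? [] ?; [left|right]; lra.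
have xy0 := mdist_ge0 x y; have xz0 := mdist_ge0 x z.
have tri := metric_triangle y x z.
(* The Gromov product of [y] and [z] at [x]: in a tree, the two segments issuing from [x] coincide
   for this length, so the points [a] and [b] at distance [s] are equal and lie in [A] and [B],
   whence [s = 0]. *)
pose s : R := (mdist y x + mdist x z - mdist y z) / 2.
have Es : 2 * s = mdist y x + mdist x z - mdist y z by rewrite /s; lra.
have s0 : 0 <= s by rewrite /s; lra.
have sy : s <= mdist y x.
  by have := metric_triangle x y z; rewrite (metric_sym x y) /s; lra.
have sz : s <= mdist x z.
  by have := metric_triangle y z x; rewrite (metric_sym z x) /s; lra.
have [a Aa ax] : exists2 a, A a & mdist a x = s.
  move: (hA) => [c [c0 c1 ciso ->]]; exists (c (mdist y x - s)).
    by exists (mdist y x - s) => //; rewrite /= in_itv/=; lra.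
  by rewrite -{2}c1 ciso ?in_itv/=; [rewrite distrC ger0_norm; lra|lra|lra].
have [b Bb xb] : exists2 b, B b & mdist x b = s.
  move: (hB) => [c [c0 c1 ciso ->]]; exists (c s).
    by exists s => //; rewrite /= in_itv/=; lra.
  by rewrite -{1}c0 ciso ?in_itv/= ?sub0r ?normrN ?ger0_norm//; lra.
have Ea : mdist y a + mdist a x = mdist y x by move: Aa; rewrite (geodesic_segmentE hA).
have Eb : mdist x b + mdist b z = mdist x z by move: Bb; rewrite (geodesic_segmentE hB).
suff ab : mdist a b = 0.
  have {}ab := mdist_positivity _ _ ab.
  have : (A `&` B) a by split=> //; rewrite ab.
  by rewrite AB => /= e; move: ax; rewrite e mdistxx /s; lra.
have ab0 := mdist_ge0 a b.
have by0 : mdist b y <= mdist y x - s.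
  have := fp b y z x.
  by rewrite (metric_sym b x) (metric_sym z x) => -[]; lra.
have := fp a b y x.
by rewrite (metric_sym a y) (metric_sym b x) => -[]; lra.
Qed.

End ZeroHyperbolic.

Section FixedPoint.
Context {R : realType} {H : groupType} (Y : pmetric R) (a : H -> Y -> Y).
Hypotheses (a1 : forall y, a 1%g y = y)
  (aM : forall g h y, a (g * h)%g y = a g (a h y))
  (a_isom : forall g x y, pdist (a g x) (a g y) = pdist x y)
  (fp : four_point (@pdist R Y) 0)
  (geo : forall x y, exists c, isometric_path (@pdist R Y) x y c).

Definition kact (g : H) (u : kolmogorov Y) : kolmogorov Y :=
  kproj (a g (krep u)).

Lemma kact_kproj g y : kact g (kproj y) = kproj (a g y).
Proof. by apply/kprojP; rewrite a_isom; apply/kprojP; rewrite krepK. Qed.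

Lemma kact1 u : kact 1%g u = u.
Proof. by rewrite -(krepK u) kact_kproj a1. Qed.

Lemma kactM g h u : kact (g * h)%g u = kact g (kact h u).
Proof. by rewrite -(krepK u) !kact_kproj aM. Qed.

Lemma kact_isometry g u v : mdist (kact g u) (kact g v) = mdist u v.
Proof. by rewrite -(krepK u) -(krepK v) !kact_kproj !mdist_kproj a_isom. Qed.

Lemma FR_fixed_point (y0 : Y) : property_FR R H ->
  exists y, forall h, pdist (a h y) y = 0.
Proof.
move=> FR; have [|u hu] := FR _ (IsometricAction kact1 kactM kact_isometry).
  apply: zero_hyperbolic_real_tree.
  - move=> x y z w; rewrite -(krepK x) -(krepK y) -(krepK z) -(krepK w).
    by rewrite !mdist_kproj; exact: fp.
  - by exists (kproj y0).
  - move=> x y; rewrite -(krepK x) -(krepK y).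
    have [c [c0 c1 ciso]] := geo (krep x) (krep y).
    exists (@kproj R Y @` (c @` `[0, pdist (krep x) (krep y)])).
    exists (@kproj R Y \o c); rewrite mdist_kproj; split.
    + by apply/kprojP.
    + by apply/kprojP.
    + by move=> s t; rewrite !in_itv/= => ? ?; rewrite mdist_kproj ciso.
    + by rewrite image_comp.
exists (krep u) => h; apply/kprojP.
by rewrite -kact_kproj krepK; exact: hu.
Qed.

End FixedPoint.

(** * Finite generation *)

Section UltrametricLength.
Context {R : realType} {H : groupType} (tau : H -> R).
Hypotheses (tau1 : tau 1%g = 0)
  (tauV : forall g, tau (g^-1)%g = tau g)
  (tauM : forall g h r, tau g <= r -> tau h <= r -> tau (g * h)%g <= r).

(* The height at which the vertical rays over [x.1] and [y.1] have merged and  *)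
(* both points have been passed. *)
Definition join_height (x y : H * R) : R :=
  Num.max (Num.max `|x.2| `|y.2|) (tau (x.1^-1 * y.1)%g).

Lemma join_height_le x y r : (join_height x y <= r) =
  [&& `|x.2| <= r, `|y.2| <= r & tau (x.1^-1 * y.1)%g <= r].
Proof. by rewrite /join_height !ge_max andbA. Qed.

Lemma join_height_ge x y : [/\ `|x.2| <= join_height x y,
  `|y.2| <= join_height x y & tau (x.1^-1 * y.1)%g <= join_height x y].
Proof. by apply/and3P; rewrite -join_height_le. Qed.

Lemma join_heightC x y : join_height x y = join_height y x.
Proof.
by rewrite /join_height (maxC `|x.2|) -(tauV (x.1^-1 * _)%g) invgM invgK.
Qed.

Lemma join_heightxx x : join_height x x = `|x.2|.
Proof. by rewrite /join_height mulVg tau1 maxxx; apply/max_idPl. Qed.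

Lemma join_height_ultra x y z :
  join_height x z <= join_height x y \/ join_height x z <= join_height y z.
Proof.
have [xx xy txy] := join_height_ge x y; have [yy yz tyz] := join_height_ge y z.
have E : (x.1^-1 * z.1 = (x.1^-1 * y.1) * (y.1^-1 * z.1))%g.
  by rewrite mulgA mulgK.
have [le|/ltW le] := leP (join_height x y) (join_height y z); [right|left].
- by rewrite join_height_le (le_trans xx le) yz E tauM//; exact: le_trans le.
- by rewrite join_height_le xx (le_trans yz le) E tauM//; exact: le_trans le.
Qed.

(** Path length in the tree obtained from one vertical ray per element of [H] by gluing the rays
    over [g] and [h] above height [tau (g^-1 * h)]. Absolute values fold negative heights onto
    positive ones, which avoids a subtype. *)
Definition tree_dist (x y : H * R) : R := 2 * join_height x y - `|x.2| - `|y.2|.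

Lemma tree_distxx x : tree_dist x x = 0.
Proof. rewrite /tree_dist join_heightxx; lra. Qed.

Lemma tree_distC x y : tree_dist x y = tree_dist y x.
Proof. rewrite /tree_dist join_heightC; lra. Qed.

Lemma tree_dist_triangle y x z : tree_dist x z <= tree_dist x y + tree_dist y z.
Proof.
rewrite /tree_dist; have [? ? _] := join_height_ge x y.
by have [? ? _] := join_height_ge y z; have [?|?] := join_height_ultra x y z; lra.
Qed.

Definition length_tree := PMetric tree_distxx tree_distC tree_dist_triangle.

Lemma tree_dist_four_point : four_point (@pdist R length_tree) 0.
Proof.
move=> x y z w; rewrite /= /tree_dist.
rewrite !addr0; have := join_height_ultra x z y; have := join_height_ultra x w y.
have := join_height_ultra z x w; have := join_height_ultra z y w.
rewrite (join_heightC z x) (join_heightC z y) (join_heightC w y).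
have [?|?] := leP (join_height x z + join_height y w)
  (join_height x w + join_height y z).
- by move=> [?|?] [?|?] [?|?] [?|?]; right; lra.
- by move=> [?|?] [?|?] [?|?] [?|?]; left; lra.
Qed.

Lemma tree_dist_fiber g s t : 0 <= s -> 0 <= t -> tree_dist (g, s) (g, t) = `|s - t|.
Proof.
move=> s0 t0; rewrite /tree_dist /join_height /= mulVg tau1.
rewrite (ger0_norm s0) (ger0_norm t0).
have [st|/ltW st] := leP s t.
  by rewrite (max_idPl t0) distrC ger0_norm ?subr_ge0//; lra.
by rewrite (max_idPl s0) ger0_norm ?subr_ge0//; lra.
Qed.

Lemma tree_dist_geodesic x y : exists c, isometric_path (@pdist R length_tree) x y c.
Proof.
set M := join_height x y; have [xM yM tM] := join_height_ge x y.
have x0 := normr_ge0 x.2; have y0 := normr_ge0 y.2.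
have norm_height z : tree_dist z (z.1, `|z.2|) = 0.
  by rewrite /tree_dist /join_height /= normr_id mulVg tau1 maxxx
    (max_idPl (normr_ge0 _)); lra.
have MP : M = tau (x.1^-1 * y.1)%g \/ M = `|x.2| \/ M = `|y.2|.
  rewrite /M /join_height; case: (leP (Num.max _ _)) => _; first by left.
  by right; case: (leP `|x.2|) => _; [right|left].
(* Climb the ray over [x.1] to height [M], then descend the ray over [y.1]. *)
pose c s := if s <= M - `|x.2| then (x.1, `|x.2| + s) else (y.1, 2 * M - `|x.2| - s).
exists c; rewrite /isometric_path /=.
have dE : tree_dist x y = 2 * M - `|x.2| - `|y.2| by [].
split.
- by rewrite /c subr_ge0 xM addr0 tree_distC norm_height.
- rewrite /c dE; case: ifP => h.
    have {h} EM : M = `|y.2| by apply/eqP; rewrite eq_le yM andbT; lra.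
    rewrite (_ : _ + _ = M); last lra.
    rewrite /tree_dist /join_height /= (ger0_norm (_ : 0 <= M)); last lra.
    by rewrite -EM maxxx (max_idPl tM) /M; lra.
  rewrite (_ : _ - (_ - _ - _) = `|y.2|); last lra.
  by rewrite tree_distC norm_height.
have cross s t : 0 <= s -> t <= tree_dist x y -> s <= M - `|x.2| -> M - `|x.2| < t ->
    tree_dist (x.1, `|x.2| + s) (y.1, 2 * M - `|x.2| - t) = t - s.
  rewrite dE => s0 tD sM Mt; rewrite /tree_dist /=.
  rewrite (ger0_norm (_ : 0 <= `|x.2| + s)); last lra.
  rewrite (ger0_norm (_ : 0 <= 2 * M - `|x.2| - t)); last lra.
  suff -> : join_height (x.1, `|x.2| + s) (y.1, 2 * M - `|x.2| - t) = M by lra.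
  apply/eqP; rewrite eq_le join_height_le /=.
  rewrite (ger0_norm (_ : 0 <= `|x.2| + s)); last lra.
  rewrite (ger0_norm (_ : 0 <= 2 * M - `|x.2| - t)); last lra.
  apply/andP; split; first by apply/and3P; split => //; lra.
  have [] := join_height_ge (x.1, `|x.2| + s) (y.1, 2 * M - `|x.2| - t).
  rewrite /= (ger0_norm (_ : 0 <= `|x.2| + s)); last lra.
  by case: MP => [->//|[|]]; lra.
move=> s t /andP[s0 s1] /andP[t0 t1]; rewrite /c.
case: ifP => hs; case: ifP => ht.
- by rewrite tree_dist_fiber; [congr `|_|; lra|lra|lra].
- move/negbT: ht; rewrite -ltNge => ht; rewrite cross//.
  by rewrite distrC ger0_norm//; lra.
- move/negbT: hs; rewrite -ltNge => hs; rewrite tree_distC cross//.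
  by rewrite ger0_norm//; lra.
- rewrite tree_dist_fiber; [|rewrite dE in s1; lra|rewrite dE in t1; lra].
  by rewrite distrC; congr `|_|; lra.
Qed.

(** Left translation preserves the tree. If [(g, t)] is fixed, the element [g h^-1 g^-1] carries it
    to [(g h^-1, t)], and distance 0 between these two points means that their rays have merged by
    height [|t|], that is, [tau h <= |t|]. *)
Lemma FR_ultrametric_length_bounded : property_FR R H ->
  exists B, forall h, tau h <= B.
Proof.
move=> FR.
have [|||||[g t] fix_gt] := @FR_fixed_point R H length_tree
    (fun h x => (h * x.1, x.2)%g) _ _ _ _ _ (1%g, 0) FR.
- by move=> [g t]; rewrite mul1g.
- by move=> g h [k t]; rewrite mulgA.
- by move=> g x y; rewrite /= /tree_dist /join_height /= invgM -mulgA mulKg.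
- exact: tree_dist_four_point.
- exact: tree_dist_geodesic.
exists `|t| => h; have := fix_gt (g * h^-1 * g^-1)%g.
rewrite /= /tree_dist; have [_ _ /=] := join_height_ge (g * h^-1 * g^-1 * g, t)%g (g, t).
rewrite mulgVK invgM invgK -mulgA mulVg mulg1; lra.
Qed.

End UltrametricLength.

Inductive generated (H : groupType) (S : set H) : H -> Prop :=
| generated1 : generated S 1%g
| generated_mem h : S h -> generated S h
| generatedM g h : generated S g -> generated S h -> generated S (g * h)%g
| generatedV g : generated S g -> generated S (g^-1)%g.

Lemma sub_generated (H : groupType) (S S' : set H) :
  S `<=` S' -> generated S `<=` generated S'.
Proof.
by move=> SS' h; elim=> [|k /SS'|k l _ ? _|k _ ?];
  [exact: generated1|exact: generated_mem|exact: generatedM|exact: generatedV].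
Qed.

(* An infinitely generated [H] is a strictly increasing union of subgroups, and *)
(* acts without fixed point on the tree of their cosets. *)
Lemma FR_finitely_generated (R : realType) (H : groupType) (len : H -> R) :
  (forall r, finite_set [set h | len h <= r]) -> property_FR R H ->
  exists2 S : set H, finite_set S & forall h, generated S h.
Proof.
move=> fin FR; pose F n := generated [set h | len h <= n%:R].
have exF h : exists n, `[< F n h >].
  have [n hn] : exists n : nat, len h <= n%:R.
    exists (Num.bound `|len h|); apply/ltW/(le_lt_trans (ler_norm _)).
    exact/archi_boundP/normr_ge0.
  by exists n; apply/asboolP; exact: generated_mem.
pose tau h : R := (ex_minn (exF h))%:R.
have F_mono m n : (m <= n)%N -> F m `<=` F n.
  move=> mn; apply: sub_generated => h /= /le_trans; apply.
  by rewrite ler_nat.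
have tauP n h : F n h <-> tau h <= n%:R.
  rewrite /tau ler_nat; case: ex_minnP => m /asboolP Fm min; split=> [/asboolP/min//|mn].
  exact: F_mono Fm.
have [|||B hB] := @FR_ultrametric_length_bounded R H tau _ _ _ FR.
- apply/eqP; rewrite eq_le ler0n andbT; apply/(tauP 0%N); exact: generated1.
- move=> g; apply/eqP; rewrite eq_le; apply/andP; split.
    by apply/tauP; apply: generatedV; apply/tauP.
  by apply/tauP; rewrite -(invgK g); apply: generatedV; apply/tauP; rewrite invgK.
- move=> g h r gr hr.
  (* Sublevel sets of [tau] are identified with the subgroups [F n] at integers only; the larger of
     the two values is an integer below [r]. *)
  have [n [gn hn nr]] : exists n : nat, [/\ tau g <= n%:R, tau h <= n%:R & n%:R <= r].
    have [gh|/ltW gh] := leP (tau g) (tau h).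
    - by exists (ex_minn (exF h)).
    - by exists (ex_minn (exF g)).
  apply: le_trans nr; apply/tauP; apply: generatedM; exact/tauP.
exists [set h | len h <= (Num.bound `|B|)%:R] => // h; apply/tauP.
apply/(le_trans (hB h))/ltW/(le_lt_trans (ler_norm _)).
exact/archi_boundP/normr_ge0.
Qed.

(** * Ultralimits of rescaled actions *)

Lemma filter_finite_forall (I T : Type) (F : set_system T) {FF : Filter F}
    (S : set I) (P : I -> set T) : finite_set S ->
  (forall i, S i -> F (P i)) -> F [set t | forall i, S i -> P i t].
Proof.
elim/Pchoice: I => I in S P *.
move=> /finite_seqP[s ->{S}]; elim: s => [|i s IH] h; first by apply: filterS filterT.
have hs : F [set t | forall j, j \in s -> P j t].
  by apply: IH => j js; apply: h; rewrite /= inE js orbT.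
apply: filterS (filterI (h i (mem_head i s)) hs) => t [Pi Ps] j /=.
by rewrite inE => /predU1P[->|/Ps].
Qed.

Section UltrafilterLimits.
Context {R : realType} {U : set_system nat} {UU : UltraFilter U}.

Lemma ultraI (A B : set nat) : U A -> U B -> U (A `&` B).
Proof. exact: filterI. Qed.

Lemma ultra_ex (A : set nat) : U A -> exists n, A n.
Proof. exact: filter_ex. Qed.

Lemma ultra_compact_cvg (T : topologicalType) (K : set T) (f : nat -> T) :
  compact K -> (\forall n \near U, K (f n)) -> exists2 p, K p & f @ U --> p.
Proof.
move=> cK KU; have [p [Kp clp]] := cK (f @ U) _ KU.
exists p => // V Vp; have [//|nV] := in_ultra_setVsetC (f @^-1` V) UU.
by have [q [nVq Vq]] := clp (~` V) V nV Vp.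
Qed.

Lemma ultra_bounded_cvg (f : nat -> R) (B : R) : (forall n, `|f n| <= B) ->
  exists l : R, forall e, 0 < e -> \forall n \near U, `|f n - l| < e.
Proof.
move=> fB; have [||l _ /cvgrPdist_lt fl] := @ultra_compact_cvg R^o `[- B, B] f.
- exact: segment_compact.
- by apply: nearW => n; rewrite /= in_itv/= -ler_norml.
exists l => e e0; have := fl e e0; apply: filterS => n /=.
by rewrite distrC.
Qed.

End UltrafilterLimits.
Arguments ultraI {U} UU {A B}.
Arguments ultra_ex {U} UU {A}.

Section Ultralimit.
Context {R : realType} {U : set_system nat} {UU : UltraFilter U}.
Context (X : metricType R) (x : nat -> X) (lam : nat -> R).
Hypothesis lam_gt0 : forall n, 0 < lam n.

Definition bounded_seq :=
  {y : nat -> X | exists B, forall n, mdist (x n) (y n) <= B * lam n}.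
Implicit Types y z w : bounded_seq.

Definition scaled_dist y z n := mdist (sval y n) (sval z n) / lam n.

Lemma scaled_dist_ge0 y z n : 0 <= scaled_dist y z n.
Proof. by rewrite divr_ge0 ?mdist_ge0// ltW. Qed.

Lemma scaled_dist_bounded y z : exists B, forall n, `|scaled_dist y z n| <= B.
Proof.
have [[B yB] [C zC]] := (svalP y, svalP z); exists (B + C) => n.
have ln := lam_gt0 n; rewrite ger0_norm ?scaled_dist_ge0//.
rewrite ler_pdivrMr// mulrDl.
apply: le_trans (metric_triangle _ (x n) _) _.
by rewrite metric_sym lerD.
Qed.

(** The limit of the rescaled distances along [U]; it exists because they are bounded, so the
    default 0 is never taken as such. *)
Definition ultra_dist y z : R :=
  xget 0 [set l | forall e, 0 < e -> U [set n | `|scaled_dist y z n - l| < e]].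

Lemma ultra_distP y z e : 0 < e ->
  U [set n | `|scaled_dist y z n - ultra_dist y z| < e].
Proof.
rewrite /ultra_dist; have [B yzB] := scaled_dist_bounded y z.
by have [l hl] := ultra_bounded_cvg yzB; case: xgetP => [_ -> /(_ e)//|/(_ l)].
Qed.

Lemma ultra_dist_unique y z (l : R) :
  (forall e, 0 < e -> U [set n | `|scaled_dist y z n - l| < e]) ->
  ultra_dist y z = l.
Proof.
move=> hl; apply/eqP; rewrite -subr_eq0; apply: contraT; rewrite -normr_gt0 => gap.
have e0 : 0 < `|ultra_dist y z - l| / 2 by lra.
have /(ultra_ex UU) [n []] := ultraI UU (hl _ e0) (ultra_distP y z e0).
have := ler_distD (scaled_dist y z n) (ultra_dist y z) l.
by rewrite (distrC (ultra_dist y z) (scaled_dist _ _ _)) /=; lra.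
Qed.

Lemma ultra_distxx y : ultra_dist y y = 0.
Proof.
apply: ultra_dist_unique => e e0; apply: nearW => n.
by rewrite /= /scaled_dist mdistxx mul0r subr0 normr0.
Qed.

Lemma ultra_distC y z : ultra_dist y z = ultra_dist z y.
Proof.
apply: ultra_dist_unique => e e0; apply: filterS (ultra_distP z y e0) => n.
by rewrite /= /scaled_dist metric_sym.
Qed.

Lemma ultra_dist_triangle y z w : ultra_dist z w <= ultra_dist z y + ultra_dist y w.
Proof.
apply/ler_addgt0Pr => e e0; have e3 : 0 < e / 3 by lra.
have /(ultra_ex UU) [n [[]]] := ultraI UU (ultraI UU (ultra_distP z w e3)
  (ultra_distP z y e3)) (ultra_distP y w e3).
rewrite /= !ltr_norml => /andP[h1 _] /andP[_ h2] /andP[_ h3].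
suff : scaled_dist z w n <= scaled_dist z y n + scaled_dist y w n by lra.
by rewrite /scaled_dist -mulrDl ler_pM2r ?invr_gt0// metric_triangle.
Qed.

Definition ultralimit := PMetric ultra_distxx ultra_distC ultra_dist_triangle.

Hypothesis lam_oo : forall B, U [set n | B <= lam n].

Lemma scaled_dist_four_point delta r n : four_point (@mdist R X) delta ->
  delta <= r * lam n -> four_point (fun y z => scaled_dist y z n) r.
Proof.
move=> fp dr y z w v; have k0 : 0 < (lam n)^-1 by rewrite invr_gt0.
have : delta * (lam n)^-1 <= r by rewrite ler_pdivrMr.
by rewrite /scaled_dist; have [] := fp (sval y n) (sval z n) (sval w n) (sval v n);
  rewrite -(ler_pM2r k0) => ? ?; [left|right]; lra.
Qed.

(** Rescaling divides the four-point constant by [lam n], which tends to infinity along [U]. *)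
Lemma ultralimit_four_point delta :
  four_point (@mdist R X) delta -> four_point (@pdist R ultralimit) 0.
Proof.
move=> fp y z w v /=; rewrite !addr0.
suff h e : 0 < e -> ultra_dist y z + ultra_dist w v <= ultra_dist y w + ultra_dist z v + e \/
    ultra_dist y z + ultra_dist w v <= ultra_dist y v + ultra_dist z w + e.
  have [le|/ltW le] := leP (ultra_dist y w + ultra_dist z v)
    (ultra_dist y v + ultra_dist z w); [right|left];
  by apply/ler_addgt0Pr => e /h[]; lra.
move=> e0; have e8 : 0 < e / 8 by lra.
have /(ultra_ex UU) [n [[[]]]] := ultraI UU (ultraI UU (ultraI UU (ultra_distP y z e8)
  (ultra_distP w v e8)) (ultraI UU (ultra_distP y v e8) (ultra_distP z w e8)))
  (ultraI UU (ultraI UU (ultra_distP y w e8) (ultra_distP z v e8))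
    (lam_oo (delta / (e / 8)))).
rewrite /= !ltr_norml ler_pdivrMr// (mulrC (lam n))
  => /andP[? ?] /andP[? ?] [/andP[? ?] /andP[? ?]].
move=> [[/andP[? ?] /andP[? ?]]] dl.
by have [] := scaled_dist_four_point fp dl y z w v => ?; [left|right]; lra.
Qed.

Hypothesis geo : geodesic_space X.

Lemma geodesic_path (p q : X) : exists c, isometric_path (@mdist R X) p q c.
Proof.
have [_ [c [c0 c1 ciso _]]] := geo p q; exists c; split.
- by rewrite c0 mdistxx.
- by rewrite c1 mdistxx.
- by move=> s t hs ht; rewrite ciso// in_itv.
Qed.

Lemma ultralimit_geodesic y z :
  exists c, isometric_path (@pdist R ultralimit) y z c.
Proof.
have [c cP] := choice (fun n => geodesic_path (sval y n) (sval z n)).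
(* The time [t] is truncated to the domain of the [n]-th rescaled geodesic, whose length may fall
   short of the limit length; the truncation disappears in the limit. *)
pose u (t : R) n := Num.max 0 (Num.min t (scaled_dist y z n)).
have uP t n : 0 <= u t n <= scaled_dist y z n.
  rewrite /u le_max lexx ge_max ge_min lexx orbT andbT.
  exact: scaled_dist_ge0.
have uL t n : 0 <= u t n * lam n <= mdist (sval y n) (sval z n).
  have := uP t n; rewrite /scaled_dist ler_pdivlMr// => /andP[u0 ->].
  by rewrite mulr_ge0// ltW.
have cd s t n : mdist (c n (u s n * lam n)) (c n (u t n * lam n)) = `|u s n - u t n| * lam n.
  have [_ _ ->//] := cP n; rewrite -mulrBl normrM (ger0_norm (ltW (lam_gt0 n)))//.
have mem t : exists B, forall n, mdist (x n) (c n (u t n * lam n)) <= B * lam n.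
  have [[B yB] [C yzC]] := (svalP y, scaled_dist_bounded y z).
  exists (B + C) => n; apply: le_trans (metric_triangle _ (sval y n) _) _.
  rewrite mulrDl lerD//.
  have [c0 _ iso] := cP n; rewrite -(mdist_positivity _ _ c0) iso ?lexx ?mdist_ge0//.
  rewrite sub0r normrN ger0_norm; last by have /andP[] := uL t n.
  rewrite ler_pM2r//; have /andP[_ h] := uP t n; apply: le_trans h _.
  exact: le_trans (ler_norm _) (yzC n).
pose p t : bounded_seq := exist _ (fun n => c n (u t n * lam n)) (mem t).
have pd s t n : scaled_dist (p s) (p t) n = `|u s n - u t n|.
  by rewrite /scaled_dist /= cd mulfK// gt_eqF.
have D0 : 0 <= ultra_dist y z := pdist_ge0 (y : ultralimit) z.
have u_near t e : 0 <= t <= ultra_dist y z -> 0 < e -> U [set n | `|u t n - t| < e].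
  move=> /andP[t0 tD] e0; apply: filterS (ultra_distP y z e0) => n.
  have := scaled_dist_ge0 y z n.
  rewrite /= !ltr_norml /u; case: (leP t) => ht.
    by rewrite (max_idPr t0); lra.
  by move=> h; rewrite (max_idPr h); lra.
exists p; split => [||s t hs ht]; apply: ultra_dist_unique => e e0.
- apply: nearW => n; rewrite /= subr0 /scaled_dist /= /u.
  rewrite (min_idPl (scaled_dist_ge0 y z n)) maxxx mul0r.
  by have [-> _ _] := cP n; rewrite mul0r normr0.
- have hD : 0 <= ultra_dist y z <= ultra_dist y z by rewrite D0 lexx.
  have e2 : 0 < e / 2 by lra.
  have E n : scaled_dist (p (ultra_dist y z)) z n =
      scaled_dist y z n - u (ultra_dist y z) n.
    have [_ c1 iso] := cP n; have /andP[uge ule] := uL (ultra_dist y z) n.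
    rewrite [LHS]/scaled_dist /= -[X in mdist _ X](mdist_positivity _ _ c1).
    rewrite iso ?uge ?ule ?lexx ?mdist_ge0// distrC ger0_norm ?subr_ge0//.
    by rewrite mulrBl mulfK ?gt_eqF.
  apply: filterS (ultraI UU (u_near _ _ hD e2) (ultra_distP y z e2)) => n [].
  rewrite /= subr0 E !ltr_norml => /andP[? ?] /andP[? ?]; lra.
- have e2 : 0 < e / 2 by lra.
  apply: filterS (ultraI UU (u_near _ _ hs e2) (u_near _ _ ht e2)) => n [] /= us ut.
  rewrite /= pd; apply: le_lt_trans (ler_dist_dist _ _) _.
  rewrite (_ : _ - _ = (u s n - s) - (u t n - t)); last lra.
  by apply: le_lt_trans (ler_normB _ _) _; lra.
Qed.

End Ultralimit.

Section UltralimitAction.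
Context {R : realType} {H : groupType} (X : metricType R) (delta : R).
Context (act : nat -> isometric_action H X) (x : nat -> X) (lam : nat -> R).
Hypotheses (fp : four_point (@mdist R X) delta) (geo : geodesic_space X)
  (lam_gt0 : forall n, 0 < lam n)
  (lam_oo : forall B, \forall n \near \oo, B <= lam n)
  (act_bounded : forall h, exists B, forall n, mdist (x n) (act n h (x n)) <= B * lam n).

(** The sequence [y] represents a fixed point of the limit action. Being fixed in the limit means
    that each element displaces [y n] by less than [e * lam n] for [U]-almost all [n], and finitely
    many such conditions hold together. *)
Lemma ultralimit_fixed_point : property_FR R H -> exists y : nat -> X,
  forall (S : set H) e B, finite_set S -> 0 < e ->
    exists n, B <= lam n /\ forall h, S h -> mdist (act n h (y n)) (y n) < e * lam n.
Proof.
have [U [UU Uoo]] := ultraFilterLemma (eventually_filter : ProperFilter \oo).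
have U_oo B : U [set n | B <= lam n].
  exact/Uoo/lam_oo.
have mem h (y : bounded_seq x lam) : exists B, forall n,
    mdist (x n) (act n h (sval y n)) <= B * lam n.
  have [[B yB] [C hC]] := (svalP y, act_bounded h); exists (C + B) => n.
  apply: le_trans (metric_triangle _ (act n h (x n)) _) _.
  by rewrite iact_isometry mulrDl lerD.
pose L := @ultralimit R U UU X x lam lam_gt0.
pose a h (y : L) : L :=
  exist _ (fun n => act n h (sval y n)) (mem h y).
have mem0 : exists B, forall n, mdist (x n) (x n) <= B * lam n.
  by exists 0 => n; rewrite mdistxx mul0r.
move=> FR; have [|||||y yfix] := @FR_fixed_point R H L a _ _ _ _ _
  (exist _ x mem0) FR.
- by move=> [y yB]; apply: eq_exist => /=; apply/funext => n; rewrite iact1.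
- by move=> g h [y yB]; apply: eq_exist => /=; apply/funext => n; rewrite iactM.
- move=> g y z /=; apply: (ultra_dist_unique lam_gt0) => e e0.
  apply: filterS (ultra_distP lam_gt0 y z e0) => n.
  by rewrite /= /scaled_dist /= iact_isometry.
- exact: ultralimit_four_point fp.
- by move=> y z; exact: ultralimit_geodesic.
exists (sval y) => S e B Sfin e0.
have US : U [set n | forall h, S h ->
    mdist (act n h (sval y n)) (sval y n) < e * lam n].
  apply: filter_finite_forall => // h Sh.
  apply: filterS (ultra_distP lam_gt0 (a h y) y e0) => n.
  have -> : ultra_dist (U := U) (a h y) y = 0 := yfix h.
  by rewrite /= subr0 ltr_norml /scaled_dist/= ltr_pdivrMr// => /andP[].
by have /(ultra_ex UU) [n [/= hn hB]] := ultraI UU US (U_oo B); exists n.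
Qed.

End UltralimitAction.

(** * Geodesic rays in hyperbolic spaces *)

Section HyperbolicGeometry.
Context {R : realType} {X : metricType R} (delta : R).
Hypotheses (delta_ge0 : 0 <= delta) (fp : four_point (@mdist R X) delta).
Implicit Types (x y z w : X) (c : geodesic_ray X).

Lemma gromov_product_hyp w x y z :
  gromov_product w x y <= gromov_product w x z + delta \/
  gromov_product w y z <= gromov_product w x z + delta.
Proof.
rewrite /gromov_product; have := delta_ge0.
have := fp x z y w; rewrite (metric_sym z y) => -[]; [left|right]; lra.
Qed.

Lemma gromov_productC w x y : gromov_product w x y = gromov_product w y x.
Proof. by rewrite /gromov_product (metric_sym x y) (addrC (mdist x w)). Qed.

Lemma gromov_product_ge0 w x y : 0 <= gromov_product w x y.
Proof.
rewrite /gromov_product divr_ge0//.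
by have := metric_triangle x w y; rewrite (metric_sym w y); lra.
Qed.

Lemma ray_dist c s t : 0 <= s <= t -> mdist (c s) (c t) = t - s.
Proof.
move=> /andP[s0 st]; rewrite ray_isometry ?(le_trans s0)//.
by rewrite distrC ger0_norm// subr_ge0.
Qed.

Lemma ray_dist0 c t : 0 <= t -> mdist (c 0) (c t) = t.
Proof. by move=> t0; rewrite ray_dist ?lexx// subr0. Qed.

Lemma ray_dist_ge c x t : 0 <= t -> t - mdist x (c 0) <= mdist x (c t).
Proof.
move=> t0; have := metric_triangle (c 0) x (c t).
by rewrite ray_dist0// (metric_sym (c 0) x); lra.
Qed.

Lemma ray_product_mono c y s t : 0 <= s <= t ->
  gromov_product (c 0) y (c s) <= gromov_product (c 0) y (c t).
Proof.
move=> st; have /andP[s0 s_t] := st; rewrite /gromov_product.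
rewrite !(metric_sym (c _) (c 0)) !ray_dist0 ?(le_trans s0)//.
by have := metric_triangle y (c s) (c t); rewrite (ray_dist c st); lra.
Qed.

Lemma rays_product_mono c c' s t : c 0 = c' 0 -> 0 <= s <= t ->
  gromov_product (c 0) (c s) (c' s) <= gromov_product (c 0) (c t) (c' t).
Proof.
move=> cc' st; have /andP[s0 s_t] := st.
apply: (le_trans (y := gromov_product (c 0) (c s) (c' t))).
  by rewrite cc' ray_product_mono.
by rewrite !(gromov_productC _ _ (c' t)) ray_product_mono.
Qed.

Lemma ray_endE c c' (K : R) :
  (forall t, 0 <= t -> mdist (c t) (c' t) <= K) -> ray_end c = ray_end c'.
Proof. by move=> h; apply/ray_endP; exists K. Qed.

(** Busemann cocycles of asymptotic rays agree up to [delta]: for large [t] the pairing of [x] with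
    [z] and of [c t] with [c' t] is too short to be the right alternative of the four-point
    inequality. *)
Lemma asymptotic_cocycle c c' x z : ray_end c = ray_end c' ->
  \forall t \near +oo, mdist x (c t) + mdist z (c' t)
    <= mdist x (c' t) + mdist z (c t) + delta.
Proof.
move=> /ray_endP[K cc'].
near=> t.
have t0 : 0 <= t by near: t; apply: nbhs_pinfty_ge; exact: num_real.
have tbig : mdist x z + K + delta + mdist x (c 0) + mdist z (c' 0) + 1 <= t.
  by near: t; apply: nbhs_pinfty_ge; exact: num_real.
have := ray_dist_ge c x t0; have := ray_dist_ge c' z t0; have := cc' t t0.
have := fp x (c t) z (c' t); rewrite (metric_sym (c t) z).
have := mdist_ge0 (c t) (c' t); have := mdist_ge0 x z; have := delta_ge0.
have := mdist_ge0 x (c 0); have := mdist_ge0 z (c' 0); have := mdist_ge0 x (c' t).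
by have := mdist_ge0 z (c t) => ? ? ? ? ? ? ? [?|?]; lra.
Unshelve. all: by end_near. Qed.

Lemma asymptotic_product c c' x B : ray_end c = ray_end c' ->
  \forall t \near +oo, forall w, gromov_product x (c t) w <= B ->
    gromov_product x (c' t) w <= B + delta.
Proof.
move=> /ray_endP[K cc']; near=> t => w.
have t0 : 0 <= t by near: t; apply: nbhs_pinfty_ge; exact: num_real.
have tbig : B + delta + 1 + (mdist x (c 0) + mdist x (c' 0) + K) / 2 <= t.
  by near: t; apply: nbhs_pinfty_ge; exact: num_real.
have := gromov_product_hyp x (c t) (c' t) w.
have := ray_dist_ge c x t0; have := ray_dist_ge c' x t0; have := cc' t t0.
rewrite {1}/gromov_product (metric_sym (c t) x) (metric_sym (c' t) x).
by move=> ? ? ? [?|?] ?; lra.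
Unshelve. all: by end_near. Qed.

(** If the products were unbounded, comparing [c t] with [c' t] through [c s] and [c' s] for large
    [s] would give a product at least [t - 2 * delta], so the rays would stay within [4 * delta] of
    each other. *)
Lemma distinct_ends_product c c' : c 0 = c' 0 -> ray_end c <> ray_end c' ->
  exists B, forall t, 0 <= t -> gromov_product (c 0) (c t) (c' t) <= B.
Proof.
move=> c0 cc'; apply: contrapT => nB; apply: cc'.
apply: (@ray_endE _ _ (4 * delta)) => t t0.
have [s s0 st] : exists2 s, 0 <= s & t < gromov_product (c 0) (c s) (c' s).
  apply: contrapT => nst; apply: nB; exists t => s s0.
  by rewrite leNgt; apply/negP => ?; apply: nst; exists s.
have ts : 0 <= t <= s.
  rewrite t0; apply/(le_trans (ltW st)); rewrite /gromov_product.
  rewrite {2}c0 !(metric_sym (_ s) (_ 0)) !ray_dist0//.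
  by have := mdist_ge0 (c s) (c' s); lra.
have E u : 0 <= u <= s -> gromov_product (c 0) (c u) (c s) = u.
  move=> us; have /andP[? ?] := us; rewrite /gromov_product (ray_dist c us).
  by rewrite !(metric_sym (c _) (c 0)) !ray_dist0//; lra.
have E' u : 0 <= u <= s -> gromov_product (c 0) (c' u) (c' s) = u.
  move=> us; have /andP[? ?] := us; rewrite /gromov_product (ray_dist c' us) c0.
  by rewrite !(metric_sym (c' _) (c' 0)) !ray_dist0//; lra.
have h1 := gromov_product_hyp (c 0) (c t) (c s) (c' s).
have h2 := gromov_product_hyp (c 0) (c t) (c' s) (c' t).
rewrite E// in h1; rewrite (gromov_productC _ (c' s) (c' t)) E'// in h2.
suff : t - 2 * delta <= gromov_product (c 0) (c t) (c' t).
  rewrite /gromov_product {2}c0 !(metric_sym (_ t) (_ 0)) !ray_dist0//; lra.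
by have := delta_ge0; case: h1; case: h2; lra.
Qed.

Lemma projection_to_geodesic (geo : geodesic_space X) x z w : exists m : X,
  mdist z m + mdist m w = mdist z w /\ mdist x m <= gromov_product x z w + delta.
Proof.
have [_ [c [c0 c1 ciso _]]] := geo z w.
pose s := gromov_product z x w.
have s0 : 0 <= s := gromov_product_ge0 _ _ _.
have sD : s <= mdist z w.
  rewrite /s /gromov_product (metric_sym x z).
  by have := metric_triangle z w x; rewrite (metric_sym w x) (metric_sym w z); lra.
have D0 := mdist_ge0 z w.
have zs : mdist z (c s) = s.
  rewrite -{1}c0 ciso ?in_itv/= ?lexx ?s0 ?D0//.
  by rewrite sub0r normrN ger0_norm.
have ws : mdist (c s) w = mdist z w - s.
  rewrite -{1}c1 ciso ?in_itv/= ?lexx ?s0 ?D0//.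
  by rewrite distrC ger0_norm// subr_ge0.
exists (c s); split; first by lra.
have := fp x (c s) z w; rewrite (metric_sym (c s) z) zs ws.
move: zs ws; rewrite /s /gromov_product (metric_sym x z) (metric_sym w z).
rewrite (metric_sym w x) (metric_sym z x).
by move=> ? ? [?|?]; lra.
Qed.

End HyperbolicGeometry.

(** * Limits of geodesic segments *)

Section RayLimits.
Context {R : realType} {X : metricType R}.
Hypotheses (proper : proper_space X) (geo : geodesic_space X).

Lemma ray_limit {U : set_system nat} (UU : UltraFilter U) (x0 : X)
    (gam : nat -> R -> X) (L : nat -> R) :
  (forall B, U [set n | B <= L n]) -> (forall n, gam n 0 = x0) ->
  (forall n s t, 0 <= s <= L n -> 0 <= t <= L n ->
    mdist (gam n s) (gam n t) = `|s - t|) ->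
  exists c : geodesic_ray X, c 0 = x0 /\
    forall t e, 0 <= t -> 0 < e -> U [set n | mdist (gam n t) (c t) < e].
Proof.
move=> Loo gam0 iso.
have lim (t : R) : exists p, forall e, 0 <= t -> 0 < e ->
    U [set n | mdist (gam n t) p < e].
  have [t0|t0] := leP 0 t; last by exists x0.
  have [|p _ /metricType_numDomainType.cvgrPdist_lt h] :=
      @ultra_compact_cvg U UU X _ (fun n => gam n t) (@proper x0 t).
    apply: filterS (Loo t) => n /= tL.
    rewrite -(gam0 n) iso ?lexx ?t0 ?(le_trans t0)//.
    by rewrite sub0r normrN ger0_norm.
  exists p => e _ e0; apply: filterS (h e e0) => n /=.
  by rewrite metric_sym.
have [c cP] := choice lim.
have c_iso s t : 0 <= s -> 0 <= t -> mdist (c s) (c t) = `|s - t|.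
  move=> s0 t0; apply/eqP; rewrite -subr_eq0; apply: contraT.
  rewrite -normr_gt0 => gap; have e0 : 0 < `|mdist (c s) (c t) - `|s - t| | / 2 by lra.
  have /(ultra_ex UU) [n [[/= hs ht] /= hL]] := ultraI UU (ultraI UU (cP s _ s0 e0) (cP t _ t0 e0))
    (Loo (s + t)).
  have /= hst := iso n s t; rewrite -hst in e0 gap hs ht; try lra.
  have := metric_triangle (gam n s) (c s) (gam n t).
  have := metric_triangle (c s) (c t) (gam n t).
  have := metric_triangle (c s) (gam n s) (c t).
  have := metric_triangle (gam n s) (gam n t) (c t).
  rewrite (metric_sym (c t) (gam n t)) (metric_sym (c s) (gam n s)) => h1 h2 h3 h4.
  have : `|mdist (c s) (c t) - mdist (gam n s) (gam n t)| <= 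
    mdist (gam n s) (c s) + mdist (gam n t) (c t) by rewrite ler_norml; lra.
  lra.
exists (GeodesicRay c_iso); split=> [|t e t0 e0]; last exact: cP.
apply: contrapT => /eqP; rewrite -mdist_gt0 => e0.
have /(ultra_ex UU) [n /=] := cP 0 _ (lexx 0) e0.
by rewrite gam0 metric_sym ltxx.
Qed.

(** The ray is the limit of segments from [x0] to the points [c n]. *)
Lemma ray_from delta : 0 <= delta -> four_point (@mdist R X) delta ->
  forall (x0 : X) (c : geodesic_ray X),
  exists c' : geodesic_ray X, c' 0 = x0 /\ ray_end c' = ray_end c.
Proof.
move=> delta_ge0 fp x0 c.
have [gam gamP] := choice (fun n : nat => geodesic_path geo x0 (c n%:R)).
have [U [UU Uoo]] := ultraFilterLemma (eventually_filter : ProperFilter \oo).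
pose L n := mdist x0 (c n%:R).
have n_oo (B : R) : U [set n : nat | B <= n%:R] by exact/Uoo/nbhs_infty_ger.
have Loo B : U [set n | B <= L n].
  apply: filterS (n_oo (B + mdist x0 (c 0))) => n /=.
  by have := ray_dist_ge c x0 (ler0n R n); rewrite /L; lra.
have gam0 n : gam n 0 = x0 by apply: mdist_positivity; have [] := gamP n.
have iso n s t : 0 <= s <= L n -> 0 <= t <= L n -> mdist (gam n s) (gam n t) = `|s - t|.
  by move=> hs ht; have [_ _ ->] := gamP n.
have [c' [c'0 c'P]] := ray_limit UU Loo gam0 iso.
exists c'; split=> //; pose e := mdist x0 (c 0).
apply: (@ray_endE _ _ _ _ (3 * e + 2 * delta + 1)) => t t0.
have /(ultra_ex UU) [n [[/= hL hn] hc]] := ultraI UU (ultraI UU (Loo t) (n_oo t))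
  (c'P t 1 t0 ltr01).
have tn : mdist (c t) (c n%:R) = n%:R - t by rewrite ray_dist// t0.
have gt : mdist x0 (gam n t) = t.
  by rewrite -(gam0 n) iso ?lexx ?t0 ?mdist_ge0// sub0r normrN ger0_norm.
have gn : mdist (gam n t) (c n%:R) = L n - t.
  have [_ c1 _] := gamP n; rewrite -(mdist_positivity _ _ c1) iso ?t0 ?lexx ?mdist_ge0//.
  by rewrite distrC ger0_norm// subr_ge0.
have := metric_triangle x0 (c 0) (c t); have := metric_triangle x0 (c t) (c n%:R).
have := ray_dist_ge c x0 t0; rewrite ray_dist0// -/e.
have := metric_triangle x0 (c 0) (c n%:R); rewrite ray_dist0// -/e -/(L n) tn.
have := metric_triangle (c' t) (gam n t) (c t); rewrite (metric_sym (c' t) (gam n t)).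
have := ray_dist_ge c x0 (ler0n R n); rewrite -/(L n) -/e.
have := fp (gam n t) (c t) x0 (c n%:R); rewrite gn tn !(metric_sym _ x0) gt -/(L n).
have := mdist_ge0 x0 (c 0); rewrite -/e.
by move=> ? [?|?]; lra.
Qed.

End RayLimits.

(** * Topology of the ideal boundary *)

Section Boundary.
Context {R : realType} {X : metricType R} (delta : R) (x0 : X).
Hypotheses (delta_ge0 : 0 <= delta) (fp : four_point (@mdist R X) delta).
Context (rho : ideal_boundary X -> geodesic_ray X).
Hypotheses (rho0 : forall p, rho p 0 = x0) (rhoK : forall p, ray_end (rho p) = p).
Implicit Types p q : ideal_boundary X.

Lemma rho_dist p t : 0 <= t -> mdist x0 (rho p t) = t.
Proof. by move=> t0; rewrite -(rho0 p) ray_dist0. Qed.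

Lemma rho_product_mono p q s t : 0 <= s <= t ->
  gromov_product x0 (rho p s) (rho q s) <= gromov_product x0 (rho p t) (rho q t).
Proof. by move=> st; rewrite -(rho0 p) rays_product_mono// !rho0. Qed.

Lemma rho_product_same p t : 0 <= t -> gromov_product x0 (rho p t) (rho p t) = t.
Proof.
move=> t0; rewrite /gromov_product mdistxx !(metric_sym _ x0) rho_dist//; lra.
Qed.

Lemma rho_distinct p q : p <> q -> exists B, forall t, 0 <= t ->
  gromov_product x0 (rho p t) (rho q t) <= B.
Proof.
move=> pq; have [||B hB] := @distinct_ends_product R X _ delta_ge0 fp (rho p) (rho q).
- by rewrite !rho0.
- by rewrite !rhoK.
by exists B => t t0; rewrite -(rho0 p) hB.
Qed.

(** Neighbourhoods of [p] read off the chosen rays. Products along rays from [x0] grow with time, so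
    a single large value suffices. *)
Definition close (p : ideal_boundary X) (r : R) : set (ideal_boundary X) :=
  [set q | exists2 t : R, 0 <= t & r <= gromov_product x0 (rho p t) (rho q t)].

Lemma close_trans p q q' r r' : close p r q -> close q r' q' ->
  close p (Num.min r r' - delta) q'.
Proof.
move=> [s s0 hs] [t t0 ht]; pose u := Num.max s t.
have su : 0 <= s <= u by rewrite s0 le_max lexx.
have tu : 0 <= t <= u by rewrite t0 le_max lexx orbT.
exists u; first by rewrite le_max s0.
have := rho_product_mono p q su; have := rho_product_mono q q' tu.
have := gromov_product_hyp delta_ge0 fp x0 (rho p u) (rho q u) (rho q' u).
rewrite lerBlDr ge_min => -[h|h] ? ?; apply/orP; [left|right]; lra.
Qed.

Lemma close_sym p q r : close p r q -> close q r p.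
Proof. by move=> [t t0 h]; exists t => //; rewrite gromov_productC. Qed.

(** Moving the basepoint costs [mdist x0 z], replacing the two rays costs [2 * delta], and 1 makes
    the contradiction strict. *)
Lemma shadow_close p q z r :
  shadow z p r q -> close p (r - mdist x0 z - 2 * delta - 1) q.
Proof.
move=> [c [c' [cz c'z cp c'q h]]]; set b := r - _ - _ - _.
have h1 := @asymptotic_product R X _ delta_ge0 fp (rho p) c x0
  b (etrans (rhoK p) (esym cp)).
have h2 := @asymptotic_product R X _ delta_ge0 fp (rho q) c' x0
  (b + delta) (etrans (rhoK q) (esym c'q)).
apply: contrapT => nclose.
have small t : 0 <= t -> gromov_product x0 (rho p t) (rho q t) < b.
  by move=> t0; rewrite ltNge; apply/negP => ?; apply: nclose; exists t.
near (pinfty_nbhs R) => t.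
have t0 : 0 <= t by near: t; apply: nbhs_pinfty_ge; exact: num_real.
have h1t : forall w, gromov_product x0 (rho p t) w <= b ->
    gromov_product x0 (c t) w <= b + delta by near: t; exact: h1.
have h2t : forall w, gromov_product x0 (rho q t) w <= b + delta ->
    gromov_product x0 (c' t) w <= b + delta + delta by near: t; exact: h2.
have : r <= gromov_product z (c t) (c' t) by near: t; exact: h.
have r1 := h1t _ (ltW (small t t0)).
have : gromov_product x0 (c' t) (c t) <= b + delta + delta.
  by have := h2t (c t); rewrite (gromov_productC _ (rho q t)) => /(_ r1).
rewrite gromov_productC /b /gromov_product.
have := metric_triangle (c t) x0 z; have := metric_triangle (c' t) x0 z; lra.
Unshelve. all: by end_near. Qed.

Lemma nbhs_close p r : nbhs p (close p r).
Proof.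
(* [close p r] need not be open itself; [W] is an open set between [p] and it, by [close_trans]. *)
pose W := [set q | exists s, close q s `<=` close p r].
have Wclose : W `<=` close p r.
  move=> q [s]; apply; exists `|s| => //.
  by rewrite rho_product_same// ler_norm.
have oW : open W.
  move=> q [s hs] z; exists (s + 3 * delta + mdist x0 z + 1) => q' /shadow_close h.
  exists (s + delta) => q'' h'; apply: hs.
  have := close_trans h h'.
  by rewrite (_ : _ - _ - _ - _ = s + delta) ?minxx ?addrK//; lra.
by apply: (filterS Wclose); apply: open_nbhs_nbhs; split=> //; exists r.
Qed.

Lemma close_distinct p q r s : (forall t, 0 <= t ->
  gromov_product x0 (rho p t) (rho q t) <= r) -> r < s -> ~ close p s q.
Proof. by move=> h rs [t t0]; have := h t t0; lra. Qed.

Lemma cvg_distinct_product (u v : nat -> ideal_boundary X) p q : p <> q ->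
  u @ \oo --> p -> v @ \oo --> q ->
  exists B, \forall n \near \oo, forall t, 0 <= t ->
    gromov_product x0 (rho (u n) t) (rho (v n) t) <= B.
Proof.
move=> pq up vq; have [M hM] := rho_distinct pq.
exists (M + 2 * delta + 1); near=> n => t t0; rewrite leNgt; apply/negP => h.
have pu : close p (M + 2 * delta + 1) (u n) by near: n; exact: up (nbhs_close _ _).
have /close_sym qv : close q (M + 2 * delta + 1) (v n) by near: n; exact: vq (nbhs_close _ _).
have uv : close (u n) (M + 2 * delta + 1) (v n) by exists t => //; exact: ltW.
have := close_trans pu (close_trans uv qv).
have d0 := delta_ge0.
rewrite minxx (min_idPr _); last lra.
by apply: (close_distinct hM); lra.
Unshelve. all: by end_near. Qed.

Lemma compact_product_bounded (K : set (ideal_boundary X)) p :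
  compact K -> ~ K p -> exists B, forall q t, K q -> 0 <= t ->
    gromov_product x0 (rho q t) (rho p t) <= B.
Proof.
move=> cK Kp; apply: contrapT => nB.
have /choice [q qP] : forall n : nat, exists q, K q /\ close q n%:R p.
  move=> n; apply: contrapT => nq; apply: nB; exists n%:R => q t Kq t0.
  rewrite leNgt; apply/negP => h; apply: nq; exists q; split=> //.
  by exists t => //; exact: ltW.
have [U [UU Uoo]] := ultraFilterLemma (eventually_filter : ProperFilter \oo).
have [|q0 Kq0 qq0] := @ultra_compact_cvg U UU _ K q cK.
  by apply: nearW => n; have [] := qP n.
have q0p : q0 <> p by move=> e; apply: Kp; rewrite -e.
have [M hM] := rho_distinct q0p.
have d0 := delta_ge0.
have Un : U [set n : nat | M + 2 * delta + 1 <= n%:R] by exact/Uoo/nbhs_infty_ger.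
have Uq : U [set n | close q0 (M + 2 * delta + 1) (q n)] by exact: qq0 (nbhs_close _ _).
have /(ultra_ex UU) [n [/= hn hq]] := ultraI UU Un Uq.
have := close_trans hq (qP n).2.
by rewrite (min_idPl hn); apply: (close_distinct hM); lra.
Qed.

End Boundary.

(** * Cuspidal points *)

Lemma finite_set_ex_not (I : Type) (S : set I) (u : nat -> I) :
  finite_set S -> injective u -> exists n, ~ S (u n).
Proof.
elim/Pchoice: I => I in S u *.
move=> finS inju; apply: contrapT => nS; apply: infinite_nat.
apply: (@sub_finite_set _ _ (u @^-1` S)).
  by move=> n _; apply: contrapT => ?; apply: nS; exists n.
by apply: finite_preimage => // x y _ _; exact: inju.
Qed.

Section CuspidalPoints.
Context {R : realType} {G : groupType} {X : metricType R} (delta : R) (x0 : X).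
Context (a : isometric_action G X).
Hypotheses (delta_ge0 : 0 <= delta) (fp : four_point (@mdist R X) delta).
Hypotheses (proper : proper_space X) (pd : properly_discontinuous a).
Context (rho : ideal_boundary X -> geodesic_ray X).
Hypotheses (rho0 : forall p, rho p 0 = x0) (rhoK : forall p, ray_end (rho p) = p).
Implicit Types (p q : ideal_boundary X) (g h k : G).
Local Notation ba := (boundary_act a).

Lemma finite_displacement (r : R) : finite_set [set g | mdist x0 (a g x0) <= r].
Proof.
apply: sub_finite_set (pd (@proper x0 `|r|)) => g /= gr.
exists (a g x0); split; first by exists x0 => //=; rewrite mdistxx.
exact: le_trans gr (ler_norm r).
Qed.

Lemma iactV g x y : mdist (a g x) y = mdist x (a g^-1%g y).
Proof. by rewrite -(iact_isometry a g^-1%g) -iactM mulVg iact1. Qed.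

Lemma gromov_product_act g w x y :
  gromov_product (a g w) (a g x) (a g y) = gromov_product w x y.
Proof. by rewrite /gromov_product !iact_isometry. Qed.

Lemma boundary_act_inj g : injective (ba g).
Proof.
by move=> p q /(congr1 (ba g^-1%g)); rewrite -!boundary_actM mulVg !boundary_act1.
Qed.

Lemma rho_act g p : ray_end (ray_act a g (rho p)) = ray_end (rho (ba g p)).
Proof. by rewrite -boundary_act_ray_end !rhoK. Qed.

Lemma translate_product g p q x B :
  (\forall t \near +oo, gromov_product x (rho (ba g p) t) (rho (ba g q) t) <= B) ->
  \forall t \near +oo, gromov_product (a g^-1%g x) (rho p t) (rho q t) <= B + 2 * delta.
Proof.
move=> hB; have h1 := @asymptotic_product R X _ delta_ge0 fp _ _ x B (esym (rho_act g p)).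
have h2 := @asymptotic_product R X _ delta_ge0 fp _ _ x (B + delta) (esym (rho_act g q)).
near=> t.
have ht : gromov_product x (rho (ba g p) t) (rho (ba g q) t) <= B by near: t; exact: hB.
have h1t : forall w, gromov_product x (rho (ba g p) t) w <= B ->
  gromov_product x (a g (rho p t)) w <= B + delta by near: t; exact: h1.
have h2t : forall w, gromov_product x (rho (ba g q) t) w <= B + delta ->
  gromov_product x (a g (rho q t)) w <= B + delta + delta by near: t; exact: h2.
rewrite -(gromov_product_act g) -iactM mulgV iact1.
have := h1t _ ht; rewrite gromov_productC => /h2t; rewrite gromov_productC; lra.
Unshelve. all: by end_near. Qed.

(* [t - mdist (a g x0) (rho p t)] is the height of [a g x0] towards [p]. *)
Definition cuspidal (sigma : R) p := forall g (t : R), 0 <= t ->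
  t - sigma <= mdist (a g x0) (rho p t).

Lemma stabilizer_height sigma p g : cuspidal sigma p -> ba g p = p ->
  \forall t \near +oo, mdist (a g x0) (rho p t) <= t + sigma + delta.
Proof.
move=> cp gp; have e : ray_end (rho p) = ray_end (ray_act a g (rho p)).
  by rewrite rho_act gp.
have h := @asymptotic_cocycle R X _ delta_ge0 fp _ _ (a g x0) x0 e.
near=> t.
have t0 : 0 <= t by near: t; apply: nbhs_pinfty_ge; exact: num_real.
have : mdist (a g x0) (rho p t) + mdist x0 (a g (rho p t)) <=
  mdist (a g x0) (a g (rho p t)) + mdist x0 (rho p t) + delta by near: t; exact: h.
have -> : mdist x0 (a g (rho p t)) = mdist (a g^-1%g x0) (rho p t).
  by rewrite iactV invgK.
rewrite iact_isometry (rho_dist rho0)//.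
have := cp g^-1%g t t0; lra.
Unshelve. all: by end_near. Qed.

(** An orbit point near the geodesic from [p] to [q] is either close to [x0] or far out on the side
    of [q]: far out on the side of [p] it would have too large a height. *)
Lemma cuspidal_far sigma p q g (m B t : R) : cuspidal sigma p -> 0 <= t ->
  gromov_product x0 (rho p t) (rho q t) <= m ->
  gromov_product (a g x0) (rho p t) (rho q t) <= B ->
  mdist x0 (a g x0) <= 2 * B + 2 * m + delta + sigma \/
  t - 2 * m - delta + mdist x0 (a g x0) <= mdist (a g x0) (rho p t) /\
  mdist (a g x0) (rho q t) <= t - mdist x0 (a g x0) + 2 * B + 2 * m + delta.
Proof.
move=> cp t0; rewrite /gromov_product.
rewrite (metric_sym _ x0) (metric_sym (rho q t) x0) !(rho_dist rho0)//.
rewrite (metric_sym _ (a g x0)) (metric_sym (rho q t) (a g x0)).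
have := cp g t t0; have := fp x0 (a g x0) (rho p t) (rho q t).
rewrite !(rho_dist rho0)//.
have := metric_triangle (rho p t) x0 (rho q t).
rewrite (metric_sym (rho p t) x0) !(rho_dist rho0)//.
by move=> ? [?|?] ? ? ?; [left|right]; lra.
Qed.

(* When the boundary has only two points, all of them are conical (constant *)
(* sequences of group elements witness it), and the contradiction comes from *)
(* the infinity of [G]: the stabilizer of [p] preserves the height up to a *)
(* constant, hence is finite. *)
Lemma cuspidal_not_conical sigma p : hausdorff_space (ideal_boundary X) ->
  (exists v : nat -> G, injective v) -> cuspidal sigma p -> ~ conical_point ba p.
Proof.
move=> haus [v vinj] cp [u [x [y [xy up uy]]]].
have [q qp] : exists q, q <> p.
  have [xp|xp] := pselect (x = p); last by exists x.
  by exists y => yp; apply: xy; rewrite xp yp.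
have pq : p <> q by move=> e; apply: qp.
have [m hm] := rho_distinct delta_ge0 fp rho0 rhoK pq.
(* With a third boundary point, the translates of [x0] by the inverses of [u n] lie eventually near
   the geodesics from [p] to [q] and from [p] to [q']. One far from [x0] would be far out towards
   both [q] and [q'], which diverge; so [u n] eventually stays in the finite set [F]. *)
have [[q' [q'p q'q]]|two_points] := pselect (exists q', q' <> p /\ q' <> q).
  have pq' : p <> q' by move=> e; apply: q'p.
  have qq' : q <> q' by move=> e; apply: q'q.
  have [m' hm'] := rho_distinct delta_ge0 fp rho0 rhoK pq'.
  have [m2 hm2] := rho_distinct delta_ge0 fp rho0 rhoK qq'.
  have [B hB] := cvg_distinct_product delta_ge0 fp rho0 rhoK xy up (uy _ qp).
  have [B' hB'] := cvg_distinct_product delta_ge0 fp rho0 rhoK xy up (uy _ q'p).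
  pose E := `|2 * (B + 2 * delta) + 2 * m + delta + sigma|
    + `|2 * (B' + 2 * delta) + 2 * m' + delta + sigma|
    + `|m2 + B + B' + m + m' + 5 * delta|.
  pose F := [set g | mdist x0 (a g x0) <= E].
  have uF : \forall n \near \oo, F (u n).
    near=> n.
    have hn : forall t, 0 <= t ->
        gromov_product x0 (rho (ba (u n) p) t) (rho (ba (u n) q) t) <= B by near: n; exact: hB.
    have hn' : forall t, 0 <= t ->
        gromov_product x0 (rho (ba (u n) p) t) (rho (ba (u n) q') t) <= B' by near: n; exact: hB'.
    have h1 : \forall t \near +oo,
        gromov_product (a (u n)^-1%g x0) (rho p t) (rho q t) <= B + 2 * delta.
      apply: translate_product; near=> t; apply: hn.
      by near: t; apply: nbhs_pinfty_ge; exact: num_real.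
    have h1' : \forall t \near +oo,
        gromov_product (a (u n)^-1%g x0) (rho p t) (rho q' t) <= B' + 2 * delta.
      apply: translate_product; near=> t; apply: hn'.
      by near: t; apply: nbhs_pinfty_ge; exact: num_real.
    near (pinfty_nbhs R) => t.
    have t0 : 0 <= t by near: t; apply: nbhs_pinfty_ge; exact: num_real.
    have ht : gromov_product (a (u n)^-1%g x0) (rho p t) (rho q t) <= B + 2 * delta.
      by near: t; exact: h1.
    have ht' : gromov_product (a (u n)^-1%g x0) (rho p t) (rho q' t) <= B' + 2 * delta.
      by near: t; exact: h1'.
    have := cuspidal_far cp t0 (hm t t0) ht; have := cuspidal_far cp t0 (hm' t t0) ht'.
    have := hm2 t t0; rewrite /gromov_product (metric_sym _ x0).
    rewrite (metric_sym (rho q' t) x0) !(rho_dist rho0)//.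
    have := metric_triangle (rho q t) (a (u n)^-1%g x0) (rho q' t).
    rewrite (metric_sym (rho q t) (a _ _)) /F /= /E.
    rewrite (metric_sym x0 (a (u n) x0)) (iactV (u n)).
    have := ler_norm (2 * (B + 2 * delta) + 2 * m + delta + sigma).
    have := ler_norm (2 * (B' + 2 * delta) + 2 * m' + delta + sigma).
    have := ler_norm (m2 + B + B' + m + m' + 5 * delta).
    have := normr_ge0 (2 * (B + 2 * delta) + 2 * m + delta + sigma).
    have := normr_ge0 (2 * (B' + 2 * delta) + 2 * m' + delta + sigma).
    have := normr_ge0 (m2 + B + B' + m + m' + 5 * delta).
    by move=> ? ? ? ? ? ? ? ? [?|[? ?]] [?|[? ?]]; lra.
  (* No fixed [g] recurs forever: its images of [q] and [q'] differ, so one of them is not the limit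
     [y]. *)
  have uNF : \forall n \near \oo, forall g, F g -> u n <> g.
    apply: (@filter_finite_forall _ _ _ _ F (fun g n => u n <> g)).
      exact: finite_displacement.
    have avoid g (r : ideal_boundary X) : r <> p -> ba g r <> y -> \forall n \near \oo, u n <> g.
      move=> rp gry; have : nbhs y (~` [set ba g r]).
        apply: open_nbhs_nbhs; split; last by move=> /= e; apply: gry.
        by rewrite openC; apply: accessible_closed_set1; exact: hausdorff_accessible.
      move=> V; have hV : \forall n \near \oo, ba (u n) r <> ba g r by exact: uy V.
      by apply: filterS hV => n nV e; apply: nV; rewrite e.
    move=> g _; have [gqy|gqy] := pselect (ba g q = y); last exact: avoid qp gqy.
    apply: (avoid g q' q'p) => gq'y; apply: qq'; apply: (@boundary_act_inj g).
    by rewrite gqy.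
  have /filter_ex [n []] : \forall n \near \oo, F (u n) /\ forall g, F g -> u n <> g.
    by near do split.
  by move=> Fn /(_ _ Fn).
pose Fx := [set g | ba g p = p].
have finFx : finite_set Fx.
  pose E := `|2 * (m + 2 * delta) + 2 * m + delta + sigma|
    + `|2 * m + sigma + 2 * delta|.
  apply: sub_finite_set (finite_displacement E) => g /= gp.
  have gVp : ba g^-1%g p = p by rewrite -{1}gp -boundary_actM mulVg boundary_act1.
  have gVq : ba g^-1%g q = q.
    have [gVq|gVq] := pselect (ba g^-1%g q = p).
      by exfalso; apply: qp; apply: (@boundary_act_inj g^-1%g); rewrite gVq gVp.
    by apply: contrapT => ?; apply: two_points; exists (ba g^-1%g q).
  have h1 : \forall t \near +oo, gromov_product (a g x0) (rho p t) (rho q t) <= m + 2 * delta.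
    have := @translate_product g^-1%g p q x0 m; rewrite invgK gVp gVq; apply.
    near=> t; apply: hm.
    by near: t; apply: nbhs_pinfty_ge; exact: num_real.
  have h2 := stabilizer_height cp gp.
  near (pinfty_nbhs R) => t.
  have t0 : 0 <= t by near: t; apply: nbhs_pinfty_ge; exact: num_real.
  have ht : gromov_product (a g x0) (rho p t) (rho q t) <= m + 2 * delta by near: t; exact: h1.
  have ht2 : mdist (a g x0) (rho p t) <= t + sigma + delta by near: t; exact: h2.
  have := cuspidal_far cp t0 (hm t t0) ht; rewrite /E.
  have := ler_norm (2 * (m + 2 * delta) + 2 * m + delta + sigma).
  have := ler_norm (2 * m + sigma + 2 * delta).
  have := normr_ge0 (2 * (m + 2 * delta) + 2 * m + delta + sigma).
  have := normr_ge0 (2 * m + sigma + 2 * delta).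
  by move=> ? ? ? ? [?|[? ?]]; lra.
have [N vN] := finite_set_ex_not finFx vinj.
have moved g : ~ Fx g -> ba g p = q.
  by move=> gp; apply: contrapT => ?; apply: two_points; exists (ba g p).
(* Elements outside [Fx] all send [p] to [q], so these two cosets exhaust the group. *)
have finG : finite_set (Fx `|` (fun g => (v N * g)%g) @` Fx).
  by rewrite finite_setU; split=> //; exact: finite_image.
have [n] := finite_set_ex_not finG vinj; apply.
have [|vn] := pselect (Fx (v n)); [by left|right].
exists ((v N)^-1 * v n)%g; last by rewrite mulgA mulgV mul1g.
by rewrite /Fx /= boundary_actM (moved _ vn) -(moved _ vN) -boundary_actM mulVg boundary_act1.
Unshelve. all: by end_near. Qed.

End CuspidalPoints.

(** * Horoballs at bounded parabolic points *)

Section CuspNeighbourhoods.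
Context {R : realType} {G : groupType} {X : metricType R} (delta : R) (x0 : X).
Context (a : isometric_action G X).
Hypotheses (delta_ge0 : 0 <= delta) (fp : four_point (@mdist R X) delta).
Context (rho : ideal_boundary X -> geodesic_ray X).
Hypotheses (rho0 : forall p, rho p 0 = x0) (rhoK : forall p, ray_end (rho p) = p).
Implicit Types (p q w : ideal_boundary X) (g h k : G).
Local Notation ba := (boundary_act a).

(* The stabilizer of [p] acts cocompactly on the complement of [p]: geodesics *)
(* ending at [p] pass near the orbit of [x0] under the stabilizer. *)
Definition horospherical (B : R) p := forall q, q <> p ->
  exists k, ba k p = p /\
    \forall t \near +oo, gromov_product (a k x0) (rho q t) (rho p t) <= B.

Lemma bounded_parabolic_horospherical p : bounded_parabolic_point ba p ->
  exists B, horospherical B p.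
Proof.
move=> [_ [K [cK Kp Kcover]]].
have [B hB] := compact_product_bounded delta_ge0 fp rho0 rhoK cK Kp.
exists (B + 2 * delta) => q qp; have [g gp Kgq] := Kcover q qp.
exists g^-1%g; split; first by rewrite -{1}gp -boundary_actM mulVg boundary_act1.
apply: (translate_product delta_ge0 fp rhoK); rewrite gp; near=> t.
by apply: hB => //; near: t; apply: nbhs_pinfty_ge; exact: num_real.
Unshelve. all: by end_near. Qed.

(** Since [g] barely moves [y], the point [y] is deep in the horoballs at both [p] and [g p]. If
    these points differed, the geodesic joining them would pass near an orbit point, whose heights
    towards both are small by cuspidality; the path through [y] would then be shorter than that
    geodesic. *)
Lemma cusp_stabilizer sigma B A C p y g : cuspidal x0 a rho sigma p -> horospherical B p ->
  (\forall t \near +oo, mdist y (rho p t) <= t - mdist y x0 + A) ->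
  mdist y (a g y) <= C -> 2 * B + 2 * A + C + 2 * sigma + delta < 2 * mdist y x0 ->
  ba g p = p.
Proof.
move=> cp hp hy yg big; apply: contrapT => gp.
have [k [kp hk]] := hp _ gp.
have e : ray_end (rho (ba g p)) = ray_end (ray_act a g (rho p)) by rewrite rho_act.
have h := @asymptotic_cocycle R X _ delta_ge0 fp _ _ y (a k x0) e.
near (pinfty_nbhs R) => t.
have t0 : 0 <= t by near: t; apply: nbhs_pinfty_ge; exact: num_real.
have : gromov_product (a k x0) (rho (ba g p) t) (rho p t) <= B by near: t; exact: hk.
have yp : mdist y (rho p t) <= t - mdist y x0 + A by near: t; exact: hy.
have : mdist y (rho (ba g p) t) + mdist (a k x0) (a g (rho p t)) <=
  mdist y (a g (rho p t)) + mdist (a k x0) (rho (ba g p) t) + delta by near: t; exact: h.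
have -> : mdist (a k x0) (a g (rho p t)) = mdist (a (g^-1 * k)%g x0) (rho p t).
  by rewrite iactM (iactV a g^-1%g) invgK.
have := cp (g^-1 * k)%g t t0; have := cp k t t0.
have := metric_triangle y (a g y) (a g (rho p t)); rewrite iact_isometry.
rewrite /gromov_product (metric_sym (rho p t) (a k x0)).
rewrite (metric_sym (rho (ba g p) t) (a k x0)).
have := metric_triangle (rho (ba g p) t) y (rho p t).
rewrite (metric_sym (rho (ba g p) t) y); lra.
Unshelve. all: by end_near. Qed.

(* If the geodesic from [x0] to [y], continued to a boundary point [w], left *)
(* the ray to [p] much before [y], it would follow the geodesic from [p] to [w], *)
(* which passes near some [a k x0] with [k] in the stabilizer of [p]; as [a k x0] *)
(* and [x0] have about the same height, [a k x0] would be closer to [y]. *)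
Lemma cusp_ray sigma B kap M s p z1 z2 y g : cuspidal x0 a rho sigma p ->
  horospherical B p ->
  (forall t, 0 <= t -> gromov_product x0 (rho z1 t) (rho z2 t) <= M) ->
  gromov_product y x0 (a g x0) <= kap ->
  (forall h, mdist y x0 - 1 <= mdist y (a h x0)) ->
  (\forall t \near +oo, s <= gromov_product x0 y (rho p t)) ->
  2 + M + kap + 3 * delta < mdist y x0 ->
  2 + sigma + 2 * B + delta < 2 * s ->
  \forall t \near +oo, mdist y (rho p t) <=
     t - mdist y x0 + 2 * kap + 1 + sigma + 6 * delta.
Proof.
move=> cp hp hM yg near_orbit hs Rbig sbig.
pose y' := a g^-1%g y.
(* As [z1] and [z2] diverge at [x0], one of them also diverges from [y'] there; its translate [w] by
   [g] continues the geodesic from [x0] to [y] beyond [y]. *)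
have [z hz] : exists z, forall t, 0 <= t -> gromov_product x0 (rho z t) y' <= M + delta.
  have [h1|h1] := pselect (forall t, 0 <= t -> gromov_product x0 (rho z1 t) y' <= M + delta).
    by exists z1.
  exists z2 => t t0; rewrite leNgt; apply/negP => ht; apply: h1 => u u0.
  rewrite leNgt; apply/negP => hu; pose v := Num.max t u.
  have tv : 0 <= t <= v by rewrite t0 le_max lexx.
  have uv : 0 <= u <= v by rewrite u0 le_max lexx orbT.
  have v0 : 0 <= v by have /andP[] := tv; lra.
  have := ray_product_mono (rho z2) y' tv; have := ray_product_mono (rho z1) y' uv.
  have := gromov_product_hyp delta_ge0 fp x0 (rho z1 v) y' (rho z2 v).
  rewrite !rho0 (gromov_productC _ y' (rho z2 t)) (gromov_productC _ y' (rho z1 _)).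
  rewrite (gromov_productC _ y' (rho z1 _)) ?(gromov_productC _ y' (rho z2 v)).
  by have := hM v v0; move=> ? [?|?]; lra.
pose w := ba g z.
have h1 := @asymptotic_product R X _ delta_ge0 fp _ _ (a g x0) (M + delta) (rho_act a rhoK g z).
have hyw : \forall t \near +oo, gromov_product y x0 (rho w t) <= kap + delta.
  near=> t.
  have t0 : 0 <= t by near: t; apply: nbhs_pinfty_ge; exact: num_real.
  have h1t : forall v, gromov_product (a g x0) (a g (rho z t)) v <= M + delta ->
    gromov_product (a g x0) (rho w t) v <= M + delta + delta by near: t; exact: h1.
  have := hz t t0; rewrite -(gromov_product_act a g) /y' -iactM mulgV iact1 => /h1t.
  have := gromov_product_hyp delta_ge0 fp y x0 (rho w t) (a g x0).
  have := near_orbit g; move: yg; rewrite /gromov_product !(metric_sym _ y).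
  rewrite (metric_sym (rho w t) (a g x0)).
  by move=> ? ? [?|?]; lra.
have [wp|wp] := pselect (w = p).
  near=> t.
  have t0 : 0 <= t by near: t; apply: nbhs_pinfty_ge; exact: num_real.
  have : gromov_product y x0 (rho w t) <= kap + delta by near: t; exact: hyw.
  rewrite wp /gromov_product !(metric_sym _ y) (rho_dist rho0)//.
  have := delta_ge0; have := cp 1%g 0 (lexx 0).
  rewrite rho0 iact1 mdistxx; lra.
have [k [kp hk]] := hp w wp.
have h2 := stabilizer_height delta_ge0 fp rho0 rhoK cp kp.
near=> t.
have t0 : 0 <= t by near: t; apply: nbhs_pinfty_ge; exact: num_real.
have yw : gromov_product y x0 (rho w t) <= kap + delta by near: t; exact: hyw.
have kw : gromov_product (a k x0) (rho w t) (rho p t) <= B by near: t; exact: hk.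
have st : s <= gromov_product x0 y (rho p t) by near: t; exact: hs.
have h2t : mdist (a k x0) (rho p t) <= t + sigma + delta by near: t; exact: h2.
have sigma0 : 0 <= sigma.
  by have := cp 1%g 0 (lexx 0); rewrite rho0 iact1 mdistxx; lra.
have := gromov_product_hyp delta_ge0 fp y x0 (rho p t) (rho w t).
have := fp y (a k x0) (rho p t) (rho w t).
have := near_orbit k; have := cp k t t0.
move: yw kw st h2t; have := delta_ge0.
rewrite /gromov_product !(metric_sym _ y) (metric_sym (rho p t) (a k x0)).
rewrite (metric_sym (rho w t) (a k x0)) (metric_sym (rho p t) (rho w t)) (metric_sym (rho p t) x0).
rewrite !(rho_dist rho0)//.
by move=> ? ? ? ? ? ? ? [?|?] [?|?]; lra.
Unshelve. all: by end_near. Qed.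

End CuspNeighbourhoods.

(** * The hull of an orbit *)

Section OrbitHull.
Context {R : realType} {G : groupType} {X : metricType R} (delta : R) (x0 : X).
Context (a : isometric_action G X).
Hypotheses (delta_ge0 : 0 <= delta) (fp : four_point (@mdist R X) delta).
Hypothesis geo : geodesic_space X.

Lemma almost_closest (A : set X) (y : X) : A !=set0 ->
  exists2 m, A m & forall z, A z -> mdist y m - 1 <= mdist y z.
Proof.
move=> [z0 Az0]; pose E := mdist y @` A.
have lbE : lbound E 0 by move=> _ [z _ <-]; exact: mdist_ge0.
have infE : has_inf E by split; [exists (mdist y z0), z0|exists 0].
have [_ [m Am <-] hm] := @inf_adherent R E 1 ltr01 infE.
exists m => // z Az; have : inf E <= mdist y z by apply: ge_inf; [exists 0|exists z].
lra.
Qed.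

Definition orbit_hull : set X := [set m | exists g h : G,
  mdist (a g x0) m + mdist m (a h x0) = mdist (a g x0) (a h x0)].

Lemma orbit_hull_act g m : orbit_hull m -> orbit_hull (a g m).
Proof.
move=> [h [k hk]]; exists (g * h)%g, (g * k)%g.
by rewrite !iactM !iact_isometry.
Qed.

(** A hull point lies between two orbit points, and at most one of them can be in the direction of
    [y]; so a path from [y] to [m] continues towards the orbit. *)
Lemma orbit_hull_side m y : orbit_hull m ->
  exists g, gromov_product m (a g x0) y <= delta.
Proof.
move=> [g [h gh]].
have E : gromov_product m (a g x0) (a h x0) = 0.
  by rewrite /gromov_product (metric_sym (a h x0) m); lra.
have := gromov_product_hyp delta_ge0 fp m (a g x0) y (a h x0).
by rewrite E add0r (gromov_productC m y) => -[?|?]; [exists g|exists h].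
Qed.

Lemma orbit_hull_quasiconvex x y m : orbit_hull x -> orbit_hull y ->
  mdist x m = mdist x y / 2 -> mdist m y = mdist x y / 2 ->
  mdist x y <= 6 * delta \/ exists2 z, orbit_hull z & mdist m z <= 3 * delta.
Proof.
move=> hx hy xm my; have [le|gt] := leP (mdist x y) (6 * delta); [by left|right].
have [g hg] := orbit_hull_side m hx; have [h hh] := orbit_hull_side m hy.
have [z [zm mz]] := projection_to_geodesic fp geo m (a g x0) (a h x0).
exists z; first by exists g, h.
suff : gromov_product m (a g x0) (a h x0) <= 2 * delta by lra.
have := gromov_product_hyp delta_ge0 fp m x (a g x0) y.
have := gromov_product_hyp delta_ge0 fp m (a g x0) (a h x0) y.
move: hg hh; have := delta_ge0; rewrite /gromov_product.
rewrite ?(metric_sym m x) (metric_sym y m) xm my.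
rewrite (metric_sym (a g x0) x) (metric_sym (a h x0) y) (metric_sym y (a h x0)).
by move=> ? ? ? [?|?] [?|?]; lra.
Qed.

(** Project [y] to a nearly closest hull point [y']. The midpoint of [y'] and its translate is near
    the hull, hence not much closer to [y] than [y'] is; by the four-point inequality this bounds
    the displacement. *)
Lemma orbit_hull_projection (C : R) (S : set G) y :
  (forall g, S g -> mdist y (a g y) <= C) ->
  exists2 y', orbit_hull y' &
    forall g, S g -> mdist y' (a g y') <= 2 * C + 2 + 8 * delta.
Proof.
move=> hy; have [|y' hy' closest] := @almost_closest orbit_hull y.
  by exists (a 1%g x0), 1%g, 1%g; rewrite !mdistxx addr0.
exists y' => // g Sg; set D := mdist y' (a g y').
have [c [c0 c1 ciso]] := geodesic_path geo y' (a g y').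
have D0 : 0 <= D := mdist_ge0 _ _.
have ym : mdist y' (c (D / 2)) = D / 2.
  rewrite -{1}(mdist_positivity _ _ c0) ciso -/D; [|lra|lra].
  by rewrite sub0r normrN ger0_norm//; lra.
have mg : mdist (c (D / 2)) (a g y') = D / 2.
  rewrite -(mdist_positivity _ _ c1) ciso -/D; [|lra|lra].
  by rewrite distrC ger0_norm//; lra.
have C0 : 0 <= C by exact: le_trans (mdist_ge0 _ _) (hy g Sg).
have d0 := delta_ge0.
have [|[z hz mz]] := orbit_hull_quasiconvex hy' (orbit_hull_act g hy') ym mg.
  by rewrite -/D; lra.
have := closest z hz; have := metric_triangle y (c (D / 2)) z.
have := metric_triangle y (a g y) (a g y'); rewrite iact_isometry.
have := hy g Sg; have := fp y (c (D / 2)) y' (a g y').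
by rewrite (metric_sym (c _) y') ym mg -/D => -[?|?]; lra.
Qed.

End OrbitHull.

Section ParabolicTranslates.
Context {R : realType} {G : groupType} {X : metricType R}.
Context (a : isometric_action G X).
Local Notation ba := (boundary_act a).

Lemma boundary_act_conj g h p :
  ba (h ^ g)%g p = p <-> ba h (ba g p) = ba g p.
Proof.
rewrite conjgE !boundary_actM; split=> [/(congr1 (ba g))|->].
  by rewrite -(boundary_actM a g g^-1%g) mulgV boundary_act1.
by rewrite -boundary_actM mulVg boundary_act1.
Qed.

Lemma parabolic_point_act g p : parabolic_point ba p -> parabolic_point ba (ba g p).
Proof.
move=> [inf nolox].
have ginj : injective (ba g).
  by move=> x y /(congr1 (ba g^-1%g)); rewrite -!boundary_actM mulVg !boundary_act1.
split=> [fin|h hp [h_oo [p1 [p2 [p12 fixh]]]]].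
  apply: inf; apply: sub_finite_set (finite_image (fun h => (h ^ g)%g) fin) => h hp.
  by exists (h ^ g^-1)%g; [apply/(boundary_act_conj g); rewrite conjgKV|rewrite conjgKV].
apply: (nolox (h ^ g)%g); first exact/boundary_act_conj.
split=> [n n0|].
  by rewrite -conjXg => /eqP; rewrite conjg_eq1 => /eqP; exact: h_oo.
have gK q : ba g (ba g^-1%g q) = q by rewrite -boundary_actM mulgV boundary_act1.
exists (ba g^-1%g p1), (ba g^-1%g p2); split.
  by move=> /(congr1 (ba g)); rewrite !gK.
have fixhE q : (ba h q = q) = (q = p1 \/ q = p2).
  by rewrite -[LHS]/([set x | ba h x = x] q) fixh.
apply/seteqP; split=> q /=.
  move=> /boundary_act_conj; rewrite fixhE.
  by case=> e; [left|right]; apply: ginj; rewrite gK.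
by case=> ->; apply/boundary_act_conj; rewrite gK fixhE; [left|right].
Qed.

End ParabolicTranslates.

(** * Almost fixed points: near the orbit or in a cusp *)

Section ThickOrParabolic.
Context {R : realType} {G : groupType} {X : metricType R} (delta : R) (x0 : X).
Context (a : isometric_action G X).
Hypotheses (delta_ge0 : 0 <= delta) (fp : four_point (@mdist R X) delta).
Hypotheses (proper : proper_space X) (geo : geodesic_space X)
  (pd : properly_discontinuous a).
Local Notation ba := (boundary_act a).
Hypotheses (haus : hausdorff_space (ideal_boundary X))
  (gf : geometrically_finite ba) (limT : limit_set ba = setT).

(* [y] is replaced by a point of the orbit hull, translated so that [x0] is *)
(* nearly its closest orbit point. *)
Lemma normalize_point (C : R) (S : set G) y :
  (forall g, S g -> mdist y (a g y) <= C) ->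
  exists k y', [/\ forall g, S g -> mdist y' (a (g ^ k)%g y') <= 2 * C + 2 + 8 * delta,
    forall h, mdist y' x0 - 1 <= mdist y' (a h x0)
    & exists h, gromov_product y' x0 (a h x0) <= delta].
Proof.
move=> hy; have [z zhull hz] := @orbit_hull_projection R G X delta x0 a delta_ge0 fp geo C S y hy.
have [_ [k _ <-] hk] := @almost_closest R X (range (fun k => a k x0)) z
  (ex_intro _ _ (ex_intro2 _ _ 1%g I erefl)).
have dist_k h : mdist (a k^-1%g z) (a h x0) = mdist z (a (k * h)%g x0).
  by rewrite iactV invgK iactM.
exists k, (a k^-1%g z); split=> [g Sg|h|].
- rewrite -iactM conjgE -(mulgA k^-1%g) mulgK iactM iact_isometry.
  exact: hz.
- rewrite dist_k (_ : mdist (a k^-1%g z) x0 = mdist z (a k x0)) ?iactV ?invgK//; apply: hk.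
  by exists (k * h)%g.
have [h hh] := @orbit_hull_side R G X delta x0 a delta_ge0 fp
  (a k^-1%g z) x0 (orbit_hull_act _ zhull).
by exists h; rewrite gromov_productC.
Qed.

(* Otherwise there are almost fixed points [y n] whose distance to the orbit *)
(* tends to infinity; normalized as above, they converge to a cuspidal point *)
(* [p], which is bounded parabolic, and they stay close to the ray to [p]. *)
Lemma thick_or_parabolic (C : R) : exists N : R, forall (S : set G) y,
  (forall g, S g -> mdist y (a g y) <= C) ->
  (exists h, forall g, S g -> mdist (a h x0) (a g (a h x0)) <= N) \/
  (exists p, parabolic_point ba p /\ forall g, S g -> ba g p = p).
Proof.
apply: contrapT => nN.
have /choice [S hS] : forall n : nat, exists S : set G,
    (exists y, forall g, S g -> mdist y (a g y) <= C) /\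
    ~ ((exists h, forall g, S g -> mdist (a h x0) (a g (a h x0)) <= n%:R) \/
  (exists p, parabolic_point ba p /\ forall g, S g -> ba g p = p)).
  move=> n; apply: contrapT => nS; apply: nN; exists n%:R => S y hy.
  by apply: contrapT => h; apply: nS; exists S; split=> //; exists y.
have not_thick n h : ~ forall g, S n g -> mdist (a h x0) (a g (a h x0)) <= n%:R.
  by move=> ?; apply: (hS n).2; left; exists h.
have not_par n p : parabolic_point ba p -> ~ forall g, S n g -> ba g p = p.
  by move=> ? ?; apply: (hS n).2; right; exists p.
pose C' := 2 * C + 2 + 8 * delta.
have /choice [ky kyP] : forall n, exists ky : G * X,
    [/\ forall g, S n g -> mdist ky.2 (a (g ^ ky.1)%g ky.2) <= C',
    forall h, mdist ky.2 x0 - 1 <= mdist ky.2 (a h x0)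
    & exists h, gromov_product ky.2 x0 (a h x0) <= delta].
  by move=> n; have [[y hy] _] := hS n; have [k [y' ?]] := normalize_point hy; exists (k, y').
pose y n := (ky n).2; pose k n := (ky n).1.
have [U [UU Uoo]] := ultraFilterLemma (eventually_filter : ProperFilter \oo).
(* Were [y n] close to [x0], the small displacement at [y n] would carry over to an orbit point,
   against [not_thick]. *)
have Loo B : U [set n | B <= mdist x0 (y n)].
  have : U [set n : nat | 2 * B + C' <= n%:R] by exact/Uoo/nbhs_infty_ger.
  apply: filterS => n /= hn; have [hC _ _] := kyP n.
  rewrite leNgt; apply/negP => small; apply: (not_thick n (k n)) => g Sg.
  have E : mdist (a (k n) x0) (a g (a (k n) x0)) = mdist x0 (a (g ^ k n)%g x0).
    by rewrite iactV conjgE !iactM.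
  rewrite E; apply: le_trans hn.
  have := hC g Sg; rewrite -/(y n) -/(k n).
  have := metric_triangle x0 (y n) (a (g ^ k n)%g x0).
  have := metric_triangle (y n) (a (g ^ k n)%g (y n)) (a (g ^ k n)%g x0).
  by rewrite iact_isometry (metric_sym (y n) x0); lra.
have [gam gamP] := choice (fun n => geodesic_path geo x0 (y n)).
have gam0 n : gam n 0 = x0 by apply: mdist_positivity; have [] := gamP n.
have iso n s t : 0 <= s <= mdist x0 (y n) -> 0 <= t <= mdist x0 (y n) ->
    mdist (gam n s) (gam n t) = `|s - t|.
  by move=> hs ht; have [_ _ ->] := gamP n.
have gamy n t : 0 <= t <= mdist x0 (y n) -> mdist (gam n t) (y n) = mdist x0 (y n) - t.
  move=> /andP[t0 t1]; have [_ c1 _] := gamP n.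
  rewrite -{1}(mdist_positivity _ _ c1) iso ?t0 ?lexx ?mdist_ge0//.
  by rewrite distrC ger0_norm// subr_ge0.
have [c [c0 cP]] := ray_limit proper UU Loo gam0 iso.
have /choice [rho rhoP] : forall p : ideal_boundary X,
    exists c : geodesic_ray X, c 0 = x0 /\ ray_end c = p.
  move=> p; have [c' [c'0 c'p]] := ray_from proper geo delta_ge0 fp x0 (repr p).
  by exists c'; split=> //; rewrite c'p; exact: reprK.
have rho0 p := (rhoP p).1; have rhoK p := (rhoP p).2.
pose p := ray_end c; have /ray_endP[K hK] := rhoK p.
have K0 : 0 <= K by apply: le_trans (hK 0 (lexx 0)); exact: mdist_ge0.
(* The orbit stays low because [x0] is nearly the closest orbit point to [y n]. The 2 is the slack 1
   of that choice plus the error 1 of the limit ray; [K] is the cost of replacing [c] by [rho p]. *)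
have cusp : cuspidal x0 a rho (2 + K) p.
  move=> g t t0; have /(ultra_ex UU) [n [/= hn tR]] := ultraI UU (cP t 1 t0 ltr01) (Loo t).
  have tn : 0 <= t <= mdist x0 (y n) by rewrite t0.
  have [_ closest _] := kyP n; have := closest g; rewrite -/(y n).
  have := gamy n t tn; have := hK t t0.
  have := metric_triangle (y n) (gam n t) (a g x0).
  have := metric_triangle (gam n t) (c t) (a g x0).
  have := metric_triangle (c t) (rho p t) (a g x0).
  rewrite (metric_sym (c t) (rho p t)) (metric_sym (y n) (gam n t)) (metric_sym (y n) x0).
  rewrite (metric_sym (rho p t) (a g x0)); lra.
have [v [vinj _]] : limit_set ba p by rewrite limT.
have [/(cuspidal_not_conical delta_ge0 fp proper pd rho0 rhoK haus (ex_intro _ v vinj) cusp)//|bp] :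
  conical_point ba p \/ bounded_parabolic_point ba p by apply: gf; rewrite limT.
have [B hB] := bounded_parabolic_horospherical delta_ge0 fp rho0 rhoK bp.
have [z zp] : exists z, z <> p.
  apply: contrapT => all_p; apply: (not_par 0 _ bp.1) => g _.
  by apply: contrapT => gp; apply: all_p; exists (ba g p).
have [M hM] := rho_distinct delta_ge0 fp rho0 rhoK zp.
(* [s] satisfies the threshold of [cusp_ray], and following [c] up to time [u] secures it. [A] is
   the error of [cusp_ray] for [kap = delta] and [sigma = 2 + K], and [N] places [y n] deep enough
   for both cusp lemmas. *)
pose s := `|2 + (2 + K) + 2 * B + delta| + 1; pose u := s + 1 + K.
have s0 : 0 <= s by rewrite addr_ge0.
have u0 : 0 <= u by rewrite /u; lra.
pose A := 2 * delta + 1 + (2 + K) + 6 * delta.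
pose N := u + `|3 + M + delta + 3 * delta| + `|2 * B + 2 * A + C' + 2 * (2 + K) + delta + 1|.
have /(ultra_ex UU) [n [/= hn hR]] := ultraI UU (cP u 1 u0 ltr01) (Loo N).
have [hC closest [h hh]] := kyP n; rewrite -/(y n) -/(k n) in hC closest hh.
have n1 := ler_norm (3 + M + delta + 3 * delta).
have n2 := ler_norm (2 * B + 2 * A + C' + 2 * (2 + K) + delta + 1).
have n3 := normr_ge0 (3 + M + delta + 3 * delta).
have n4 := normr_ge0 (2 * B + 2 * A + C' + 2 * (2 + K) + delta + 1).
have n5 := ler_norm (2 + (2 + K) + 2 * B + delta).
have uR : 0 <= u <= mdist x0 (y n) by rewrite u0 (le_trans _ hR)// /N; lra.
have d0 := delta_ge0.
have hs : \forall t \near +oo, s <= gromov_product x0 (y n) (rho p t).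
  near=> t.
  have ut : 0 <= u <= t by rewrite u0; near: t; apply: nbhs_pinfty_ge; exact: num_real.
  have := ray_product_mono (rho p) (y n) ut; rewrite rho0.
  have := gamy n u uR; have := hK u u0.
  have := metric_triangle (y n) (gam n u) (rho p u).
  have := metric_triangle (gam n u) (c u) (rho p u).
  rewrite (metric_sym (c u) (rho p u)) (metric_sym (y n) (gam n u)).
  rewrite {1}/gromov_product (metric_sym _ x0) (metric_sym (rho p u) x0) (rho_dist rho0)//.
  by rewrite /u; lra.
have Rbig : 2 + M + delta + 3 * delta < mdist (y n) x0.
  by rewrite (metric_sym (y n)); move: hR; rewrite /N; lra.
have sbig : 2 + (2 + K) + 2 * B + delta < 2 * s.
  by rewrite /s; have := normr_ge0 (2 + (2 + K) + 2 * B + delta); lra.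
have ray : \forall t \near +oo, mdist (y n) (rho p t) <= t - mdist (y n) x0 + A.
  have := cusp_ray delta_ge0 fp rho0 rhoK cusp hB hM hh closest hs Rbig sbig.
  by apply: filterS => t; rewrite /A !addrA.
apply: (not_par n (ba (k n) p) (parabolic_point_act _ bp.1)) => g Sg.
apply/boundary_act_conj.
apply: (cusp_stabilizer delta_ge0 fp rhoK cusp hB ray (hC g Sg)).
by rewrite (metric_sym (y n)); move: hR; rewrite /N; lra.
Unshelve. all: by end_near. Qed.

End ThickOrParabolic.

(** * Proof of the theorem *)

Section GeneratedActions.
Context {R : realType} {H : groupType} {X : metricType R}.
Context (S : set H) (gen : forall h, generated S h).

Lemma generated_displacement h : exists2 m, 0 <= m &
  forall (b : isometric_action H X) x (B : R), 0 <= B ->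
    (forall s, S s -> mdist x (b s x) <= B) -> mdist x (b h x) <= m * B.
Proof.
elim: (gen h) => {h} [|h Sh|g h _ [m m0 hm] _ [n n0 hn]|g _ [m m0 hm]].
- by exists 0 => // b x B B0 _; rewrite iact1 mdistxx mul0r.
- by exists 1 => // b x B B0; rewrite mul1r; exact.
- exists (m + n) => [|b x B B0 hB]; first exact: addr_ge0.
  apply: le_trans (metric_triangle _ (b g x) _) _.
  by rewrite iactM iact_isometry mulrDl lerD ?hm ?hn.
- by exists m => // b x B B0 hB; rewrite metric_sym iactV invgK hm.
Qed.

Lemma finite_upper_bound (f : H -> R) : finite_set S ->
  exists2 B, 0 <= B & forall s, S s -> f s <= B.
Proof.
move=> finS; have : \forall B \near +oo, forall s, S s -> f s <= B.
  apply: (@filter_finite_forall _ _ _ _ S (fun s B => f s <= B)) => // s _.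
  by apply: nbhs_pinfty_ge; exact: num_real.
move=> hB; near (pinfty_nbhs R) => B; exists B.
  by near: B; apply: nbhs_pinfty_ge; exact: num_real.
by near: B; exact: hB.
Unshelve. all: by end_near. Qed.

(** Otherwise the minimal displacements of [S] tend to infinity; rescaling by them, a fixed point in
    the limit tree would give points displaced by much less than the minimum. *)
Lemma FR_bounded_displacement delta (x0 : X) (act : nat -> isometric_action H X) :
  four_point (@mdist R X) delta -> geodesic_space X -> finite_set S ->
  property_FR R H ->
  exists C, forall N, exists n, (N <= n)%N /\
    exists x, forall s, S s -> mdist x (act n s x) <= C.
Proof.
move=> fp geo finS FR; apply: contrapT => unbounded.
pose A n := [set r | 0 <= r /\ exists x, forall s, S s -> mdist x (act n s x) <= r].
have A0 n : A n !=set0.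
  have [B B0 hB] := finite_upper_bound (fun s => mdist x0 (act n s x0)) finS.
  by exists B; split=> //; exists x0.
have lbA n : lbound (A n) 0 by move=> r [].
have infA n : has_inf (A n) by split=> //; exists 0.
pose lam n := inf (A n) + 1.
have lam_gt0 n : 0 < lam n.
  by have := lb_le_inf (A0 n) (lbA n); rewrite /lam; lra.
have lam_oo B : \forall n \near \oo, B <= lam n.
  have [N hN] : exists N, forall n, (N <= n)%N ->
      ~ exists x, forall s, S s -> mdist x (act n s x) <= B.
    apply: contrapT => nN; apply: unbounded; exists B => N.
    apply: contrapT => nn; apply: nN; exists N => n Nn hx.
    by apply: nn; exists n.
  exists N => // n /= Nn; suff : B <= inf (A n) by rewrite /lam; lra.
  apply: lb_le_inf => // r [_ [x hx]]; rewrite leNgt; apply/negP => rB.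
  by apply: (hN n Nn); exists x => s Ss; apply: le_trans (hx s Ss) (ltW rB).
have /choice [x hx] n : exists x, forall s, S s -> mdist x (act n s x) <= lam n.
  have [r [_ [x hx]] rlt] := inf_adherent ltr01 (infA n).
  by exists x => s Ss; apply: le_trans (hx s Ss) (ltW rlt).
have bounded h : exists B, forall n, mdist (x n) (act n h (x n)) <= B * lam n.
  by have [m _ hm] := generated_displacement h; exists m => n; exact: hm (ltW (lam_gt0 n)) (hx n).
have [y hy] := ultralimit_fixed_point fp geo lam_gt0 lam_oo bounded FR.
have e0 : 0 < 1 / 2 :> R by lra.
(* A displacement of at most half of [lam n = inf (A n) + 1] forces [lam n <= 2], against
   [3 <= lam n]. *)
have [n [big small]] := hy S (1 / 2) 3 finS e0.
have : inf (A n) <= 1 / 2 * lam n.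
  apply: ge_inf; first by exists 0.
  split; first by rewrite mulr_ge0// ltW.
  by exists (y n) => s Ss; rewrite metric_sym ltW// small.
by rewrite /lam in big *; lra.
Qed.

End GeneratedActions.

Lemma ultra_finite_value (U : set_system nat) (UU : UltraFilter U) (I : Type)
    (F : set I) (w : nat -> I) :
  finite_set F -> (forall n, F (w n)) -> exists i, U [set n | w n = i].
Proof.
move=> finF Fw; apply: contrapT => nconst.
have avoid : U [set n | forall i, F i -> w n <> i].
  apply: (@filter_finite_forall _ _ _ _ F (fun i n => w n <> i)) => // i _.
  have [eq_i|//] := in_ultra_setVsetC [set n | w n = i] UU.
  by exfalso; apply: nconst; exists i.
by have /(ultra_ex UU) [n /(_ _ (Fw n))] := avoid.
Qed.

(** Along an ultrafilter each conjugated value on [S] is constant, so two of the homomorphisms are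
    conjugate on generators, hence everywhere, and conjugation preserves kernels. *)
Lemma pigeonhole_conjugate (H G : groupType) (S : set H) (phi : nat -> H -> G)
    (c : nat -> G) (F : set G) :
  finite_set S -> (forall h, generated S h) -> finite_set F ->
  (forall n, phi n 1%g = 1%g) ->
  (forall n g h, phi n (g * h)%g = (phi n g * phi n h)%g) ->
  (forall n, exists2 m, (n <= m)%N & forall s, S s -> F (phi m s ^ c m)%g) ->
  exists n m, (n < m)%N /\ forall h, phi m h = 1%g -> phi n h = 1%g.
Proof.
move=> finS gen finF phi1 phiM hF.
have phiV n g : phi n g^-1%g = (phi n g)^-1%g.
  by apply/esym/mulg1_eq; rewrite -phiM mulgV.
have [idx idxP] := choice (fun n => let: ex_intro2 m a b := hF n in ex_intro _ m (conj a b)).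
have [U [UU Uoo]] := ultraFilterLemma (eventually_filter : ProperFilter \oo).
have /choice [v hv] s : exists g, S s -> U [set n | (phi (idx n) s ^ c (idx n))%g = g].
  have [Ss|nSs] := pselect (S s); last by exists 1%g.
  have [n|g hg] := ultra_finite_value UU (w := fun n => (phi (idx n) s ^ c (idx n))%g) finF.
    by have [_] := idxP n; exact.
  by exists g.
have Uv : U [set n | forall s, S s -> (phi (idx n) s ^ c (idx n))%g = v s].
  exact: filter_finite_forall.
have /(ultra_ex UU) [n hn] := Uv.
have Un : U [set m : nat | (idx n < m)%N] by apply: Uoo; exists (idx n).+1.
have /(ultra_ex UU) [m [hm nm]] := ultraI UU Uv Un.
exists (idx n), (idx m); split.
  by apply: leq_trans nm _; have [] := idxP m.
have E h : (phi (idx n) h ^ c (idx n))%g = (phi (idx m) h ^ c (idx m))%g.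
  elim: (gen h) => {h} [|s Ss|g h _ Eg _ Eh|g _ Eg].
  - by rewrite !phi1 !conj1g.
  - by rewrite hn// hm.
  - by rewrite !phiM !conjMg Eg Eh.
  - by rewrite !phiV !conjVg Eg.
move=> h hm1; apply/eqP; rewrite -(conjg_eq1 _ (c (idx n))) E hm1 conj1g.
exact: eqxx.
Qed.

Section IteratedEndomorphism.
Context {H : groupType} (f : {multiplicative H -> H}).

Lemma iter_endo1 n : iter n f 1%g = 1%g.
Proof.
have f1 : f 1%g = 1%g by apply: (mulgI (f 1%g)); rewrite -gmulfM !mulg1.
by elim: n => // n IH; rewrite iterS IH.
Qed.

Lemma iter_endoM n g h : iter n f (g * h)%g = (iter n f g * iter n f h)%g.
Proof. by elim: n => // n IH; rewrite !iterS IH gmulfM. Qed.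

Lemma iter_endo_surj n : (forall y, exists x, f x = y) ->
  forall y, exists x, iter n f x = y.
Proof.
move=> surj; elim: n => [|n IH] y; first by exists y.
by have [x <-] := surj y; have [w <-] := IH x; exists w.
Qed.

(** Write an element [z] of the kernel of [f] as [f^n w]. Then [f^m w = 1] because [n < m], so [w]
    is killed by [f^n] already and [z = 1]. *)
Lemma stable_kernel_injective n m : (n < m)%N ->
  (forall y, exists x, f x = y) ->
  (forall h, iter m f h = 1%g -> iter n f h = 1%g) -> injective f.
Proof.
move=> nm surj ker x y fxy; apply/divg1_eq; set z := (x / y)%g.
have fz : f z = 1%g.
  by apply: (mulIg (f y)); rewrite -gmulfM mulgVK mul1g.
have [w wz] := iter_endo_surj n surj z; rewrite -wz; apply: ker.
by rewrite -(subnK nm) iterD iterS wz fz iter_endo1.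
Qed.

End IteratedEndomorphism.

Theorem corollary5p1 (R : realType) (G : groupType)
    (peripheral : set (set G)) (H : groupClosed G) :
  relatively_hyperbolic R peripheral ->
  ~ parabolic_subgroup peripheral H ->
  property_FR R (subgroup_type H) ->
  hopfian (subgroup_type H).
Proof.
move=> [X [a [[X0 proper geo hyp] [pd [_ haus _ _] gf periph limT]]]] npar FR f surj.
have [x0 _] := X0; have [delta delta_ge0 fp] := hyperbolic_four_point X0 hyp.
pose phi n (h : subgroup_type H) : G := val (iter n f h).
have phi1 n : phi n 1%g = 1%g by rewrite /phi iter_endo1.
have phiM n g h : phi n (g * h)%g = (phi n g * phi n h)%g.
  by rewrite /phi iter_endoM.
have phi_surj n g : g \in H -> exists h, phi n h = g.
  move=> gH; have [w ew] := iter_endo_surj n surj (exist _ g gH).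
  by exists w; rewrite /phi ew.
have [S finS gen] : exists2 S : set (subgroup_type H), finite_set S & forall h, generated S h.
  apply: (FR_finitely_generated (len := fun h => mdist x0 (a (val h) x0))) FR => r.
  have := finite_displacement x0 proper pd r.
  by apply: finite_preimage => x y _ _; exact: val_inj.
have act1 n x : a (phi n 1%g) x = x by rewrite phi1 iact1.
have actM n g h x : a (phi n (g * h)%g) x = a (phi n g) (a (phi n h) x).
  by rewrite phiM iactM.
pose act n := IsometricAction (act1 n) (actM n) (fun g => iact_isometry a (phi n g)).
have [C hC] := FR_bounded_displacement gen x0 act fp geo finS FR.
have [N hN] := thick_or_parabolic x0 delta_ge0 fp proper geo pd haus gf limT C.
have thick n : exists m, (n <= m)%N /\ exists h, forall s, S s ->
    mdist (a h x0) (a (phi m s) (a h x0)) <= N.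
  have [m [nm [x hx]]] := hC n; exists m; split=> //.
  have [|[h hh]|[p [par_p fixp]]] := hN (phi m @` S) x.
  - by move=> _ [s Ss <-]; exact: hx.
  - by exists h => s Ss; apply: hh; exists s.
  (* The generators fix [p] through [phi m], hence so does the whole image of [phi m], which is [H]
     by surjectivity. *)
  exfalso; apply: npar; exists (stabilizer (boundary_act a) p).
    by rewrite -periph; exists p.
  have fix_gen h : boundary_act a (phi m h) p = p.
    elim: (gen h) => {h} [|s Ss|g h _ Eg _ Eh|g _ Eg].
    - by rewrite phi1 boundary_act1.
    - by apply: fixp; exists s.
    - by rewrite phiM boundary_actM Eh.
    - rewrite -{1}Eg -boundary_actM -phiM mulVg phi1 boundary_act1//.
  by move=> g /(phi_surj m)[h <-]; exact: fix_gen.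
(* A conjugator is chosen for every [m], with the arbitrary value 1 where no orbit point is moved by
   at most [N]. *)
have /choice [c hc] m : exists h, (exists h, forall s, S s ->
    mdist (a h x0) (a (phi m s) (a h x0)) <= N) -> forall s, S s ->
    mdist (a h x0) (a (phi m s) (a h x0)) <= N.
  by have [[h hh]|no] := pselect (exists h, forall s, S s ->
    mdist (a h x0) (a (phi m s) (a h x0)) <= N); [exists h|exists 1%g].
have [|n [m [nm ker]]] := @pigeonhole_conjugate _ _ S phi c _ finS gen
    (finite_displacement x0 proper pd N) phi1 phiM.
  move=> n; have [m [nm hm]] := thick n; exists m => // s Ss /=.
  rewrite conjgE !iactM -[X in _ <= X]/N; have := hc m hm s Ss.
  by rewrite iactV.
apply: (stable_kernel_injective nm surj) => h hm; apply: val_inj.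
by apply: ker; rewrite /phi hm.
Qed.
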